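(* The rank $SU^d$ on complete types can equivalently be defined as follows. For a complete type $p(x)\in S(A)$: (1) $SU^d(p)\ge 0$. (2) $SU^d(p)\ge\alpha+1$ if and only if there are some $k\ge 2$ and some cardinal $\lambda$ such that for every cardinal $\kappa$ there is a $k$-inconsistent collection of $\kappa$ many complete types $q(x)$ extending $p$ with $|dom(q)|\le\lambda$ and $SU^d(q)\ge\alpha$ for each of them. (3) For $\alpha$ a limit ordinal, $SU^d(p)\ge\alpha$ if and only if $SU^d(p)\ge\beta$ for all $\beta<\alpha$. $SU^d(p)$ is the supremum of all $\alpha$ such that $SU^d(p)\ge\alpha$, and $SU^d(p)=\infty$ if this supremum does not exist. That is, the function defined by this recursion coincides, on every complete type, with $SU^d$ defined as the foundation rank of dividing.
   Context: $T$ is a complete first-order theory with a monster model $\mathfrak C$ that is $\bar\kappa$-saturated and strongly $\bar\kappa$-homogeneous for a sufficiently large cardinal $\bar\kappa$ (e.g. strongly inaccessible). All parameter sets are small subsets of $\mathfrak C$ (cardinality $<\bar\kappa$), and the cardinals $\lambda,\kappa$ quantified over are small. Complete types are finitary; for $p\in S(A)$, $dom(p)=A$. $SU^d$ is the foundation rank of the relation $R_d$ on complete types, where for $p(x)\in S(A)$ and $q(x)\in S(B)$, $p\,R_d\,q$ iff $p\subseteq q$ and $q$ divides over $A$. Explicitly: $SU^d(p)\ge 0$; $SU^d(p)\ge\alpha+1$ iff there is $q$ with $p\,R_d\,q$ and $SU^d(q)\ge\alpha$; for limit $\alpha$, $SU^d(p)\ge\alpha$ iff $SU^d(p)\ge\beta$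 for all $\beta<\alpha$; $SU^d(p)$ is the supremum of the $\alpha$ with $SU^d(p)\ge\alpha$, or $\infty$ if there is no supremum. A collection of types is $k$-inconsistent if the union of any $k$ of its (distinct) members is inconsistent. *)

(* Defs.v *)
From mathcomp Require Import all_boot all_order.
From mathcomp Require Import all_classical.

Set Implicit Arguments.
Unset Strict Implicit.
Unset Printing Implicit Defensive.

Import Order.TTheory.
Local Open Scope classical_set_scope.
Local Open Scope card_scope.

Record language := Language {
  fsym : Type;
  farity : fsym -> nat;
  rsym : Type;
  rarity : rsym -> nat }.

(* Terms and formulas with free variables in V; the bound variables are de
   Bruijn indices, of which the k lowest are not yet bound. *)
Inductive term (L : language) (V : Type) (k : nat) : Type :=
| FVar (v : V)
| BVar (i : 'I_k)
| App (f : fsym L) (args : 'I_(farity f) -> term L V k).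

Inductive preformula (L : language) (V : Type) : nat -> Type :=
| Bot (k : nat) : preformula L V k
| Eq (k : nat) (s t : term L V k) : preformula L V k
| Rel (k : nat) (r : rsym L) (args : 'I_(rarity r) -> term L V k) :
    preformula L V k
| Imp (k : nat) (phi psi : preformula L V k) : preformula L V k
| All (k : nat) (phi : preformula L V k.+1) : preformula L V k.

Definition formula (L : language) (V : Type) : Type := preformula L V 0.

Definition Neg (L : language) (V : Type) (phi : formula L V) : formula L V :=
  Imp phi (Bot L V 0).

Fixpoint tmap (L : language) (V V' : Type) (k : nat) (g : V -> V')
    (t : term L V k) : term L V' k :=
  match t with
  | FVar v => FVar L k (g v)
  | BVar i => BVar L V' i
  | App f args => App (fun i => tmap g (args i))
  end.

Fixpoint fmap (L : language) (V V' : Type) (k : nat) (g : V -> V')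
    (phi : preformula L V k) : preformula L V' k :=
  match phi with
  | Bot k => Bot L V' k
  | Eq _ s t => Eq (tmap g s) (tmap g t)
  | Rel _ r args => Rel (fun i => tmap g (args i))
  | Imp _ phi psi => Imp (fmap g phi) (fmap g psi)
  | All _ phi => All (fmap g phi)
  end.

Fixpoint tfree (L : language) (V : Type) (k : nat) (t : term L V k) : set V :=
  match t with
  | FVar v => [set v]
  | BVar _ => set0
  | App f args => \bigcup_i tfree (args i)
  end.

Fixpoint free (L : language) (V : Type) (k : nat) (phi : preformula L V k) :
    set V :=
  match phi with
  | Bot _ => set0
  | Eq _ s t => tfree s `|` tfree t
  | Rel _ r args => \bigcup_i tfree (args i)
  | Imp _ phi psi => free phi `|` free psi
  | All _ phi => free phi
  end.

Record structure (L : language) := Structure {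
  carrier :> Type;
  carrier_inhabited : inhabited carrier;
  fint : forall f : fsym L, ('I_(farity f) -> carrier) -> carrier;
  rint : forall r : rsym L, ('I_(rarity r) -> carrier) -> Prop }.

Fixpoint teval (L : language) (M : structure L) (V : Type) (k : nat)
    (e : V -> M) (h : 'I_k -> M) (t : term L V k) : M :=
  match t with
  | FVar v => e v
  | BVar i => h i
  | App f args => fint (fun i => teval e h (args i))
  end.

Fixpoint presat (L : language) (M : structure L) (V : Type) (k : nat)
    (e : V -> M) (h : 'I_k -> M) (phi : preformula L V k) : Prop :=
  match phi in preformula _ _ k return ('I_k -> M) -> Prop with
  | Bot _ => fun _ => False
  | Eq _ s t => fun h => teval e h s = teval e h t
  | Rel _ r args => fun h => rint (fun i => teval e h (args i))
  | Imp _ phi psi => fun h => presat e h phi -> presat e h psi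
  | All _ phi => fun h =>
      forall a : M, presat e (fun i => oapp h a (unlift ord0 i)) phi
  end h.

Definition sat (L : language) (M : structure L) (V : Type) (e : V -> M)
    (phi : formula L V) : Prop :=
  presat e (fun i : 'I_0 => match notF (ltn_ord i) with end) phi.

Definition sentence (L : language) := formula L void.

Definition models (L : language) (M : structure L) (T : set (sentence L)) :
    Prop :=
  forall phi, T phi -> sat (of_void M) phi.

Definition entails (L : language) (T : set (sentence L)) (phi : sentence L) :
    Prop :=
  forall M : structure L, models M T -> sat (of_void M) phi.

Definition complete_theory (L : language) (T : set (sentence L)) : Prop :=
  (exists M : structure L, models M T) /\
  (forall phi, entails T phi \/ entails T (Neg phi)).

(* An L(M)-formula in the variables x_0, ..., x_(n-1): an element a of M used
   as a parameter is the "variable" [inr a], always interpreted by a. *)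
Definition pformula (L : language) (M : structure L) (n : nat) :=
  formula L ('I_n + M).

Definition over (L : language) (M : structure L) (n : nat) (A : set M) :
    set (pformula M n) :=
  [set phi | forall a : M, free phi (inr a) -> A a].

Definition psat (L : language) (M : structure L) (n : nat) (x : 'I_n -> M)
    (phi : pformula M n) : Prop :=
  @sat L M ('I_n + M) (fun v => match v with inl i => x i | inr a => a end) phi.

(* phi(x, b), for an L-formula phi(x, y) *)
Definition inst (L : language) (M : structure L) (n m : nat)
    (phi : formula L ('I_n + 'I_m)) (b : 'I_m -> M) : pformula M n :=
  @fmap L ('I_n + 'I_m) ('I_n + M) 0 (fun v =>
    match v with inl i => inl i | inr j => inr (b j) end) phi.

(* Finite satisfiability in M, i.e. consistency with the elementary diagram. *)
Definition consistent (L : language) (M : structure L) (n : nat)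
    (S : set (pformula M n)) : Prop :=
  forall F : set (pformula M n), finite_set F -> F `<=` S ->
    exists x : 'I_n -> M, forall phi, F phi -> psat x phi.

Definition implies (L : language) (M : structure L) (n : nat)
    (S : set (pformula M n)) (phi : pformula M n) : Prop :=
  ~ consistent (S `|` [set Neg phi]).

Definition complete_over (L : language) (M : structure L) (n : nat)
    (A : set M) (S : set (pformula M n)) : Prop :=
  [/\ S `<=` over A, consistent S &
      forall phi, over A phi -> S phi \/ S (Neg phi)].

(* The family of sets of formulas (S i), i in D, is k-inconsistent: any k
   members with distinct indices have an inconsistent union. *)
Definition k_inconsistent (L : language) (M : structure L) (n k : nat)
    (I : Type) (D : set I) (S : I -> set (pformula M n)) : Prop :=
  forall t : 'I_k -> I, injective t -> (forall j, D (t j)) ->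
    ~ consistent (\bigcup_j S (t j)).

(* The cardinal kappa-bar is that of a type K; the cardinals below it are the
   cardinals of the small subsets of K. *)
Definition small (K T : Type) (X : set T) : Prop := ~ ([set: K] #<= X).

(* K is a strong limit cardinal above |T| = |L| + aleph_0, the number of
   L-formulas; this holds in particular if K is strongly inaccessible and
   above |T|. *)
Definition sufficiently_large (K : Type) (L : language) : Prop :=
  (forall X : set K, small K X -> small K [set Y : set K | Y `<=` X]) /\
  small K [set: formula L nat].

Definition saturated (K : Type) (L : language) (M : structure L) : Prop :=
  forall (n : nat) (A : set M) (S : set (pformula M n)),
    small K A -> complete_over A S ->
    exists x : 'I_n -> M, forall phi, S phi -> psat x phi.

Definition automorphism (L : language) (M : structure L) (s : M -> M) : Prop :=
  [/\ bijective s,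
      forall (f : fsym L) (a : 'I_(farity f) -> M),
        s (fint a) = fint (fun i => s (a i)) &
      forall (r : rsym L) (a : 'I_(rarity r) -> M),
        rint (fun i => s (a i)) <-> rint a].

(* The restriction of g to A is an elementary map. *)
Definition elementary_on (L : language) (M : structure L) (A : set M)
    (g : M -> M) : Prop :=
  forall phi : formula L M, free phi `<=` A -> (sat id phi <-> sat g phi).

Definition strongly_homogeneous (K : Type) (L : language) (M : structure L) :
    Prop :=
  forall (A : set M) (g : M -> M), small K A -> elementary_on A g ->
    exists s : M -> M, automorphism s /\ (forall a, A a -> s a = g a).

Definition monster (K : Type) (L : language) (T : set (sentence L))
    (M : structure L) : Prop :=
  [/\ sufficiently_large K L, models M T, saturated K M &
      strongly_homogeneous K M].

Record ctype (K : Type) (L : language) (M : structure L) (n : nat) := CType {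
  dom : set M;
  fml :> set (pformula M n);
  dom_small : small K dom;
  ctypeP : complete_over dom fml }.

(* tp(b/A) = tp(b'/A) *)
Definition same_type (L : language) (M : structure L) (m : nat) (A : set M)
    (b b' : 'I_m -> M) : Prop :=
  forall phi : pformula M m, over A phi -> (psat b phi <-> psat b' phi).

Definition formula_divides (L : language) (M : structure L) (n m : nat)
    (phi : formula L ('I_n + 'I_m)) (b : 'I_m -> M) (A : set M) : Prop :=
  exists (k : nat) (c : nat -> 'I_m -> M),
    (forall i, same_type A b (c i)) /\
    k_inconsistent k [set: nat] (fun i => [set inst phi (c i)]).

Definition divides (L : language) (M : structure L) (n : nat)
    (S : set (pformula M n)) (A : set M) : Prop :=
  exists (m : nat) (phi : formula L ('I_n + 'I_m)) (b : 'I_m -> M),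
    implies S (inst phi b) /\ formula_divides phi b A.

Definition Rd (K : Type) (L : language) (M : structure L) (n : nat)
    (p q : ctype K M n) : Prop :=
  p `<=` q /\ divides q (dom p).

Definition is_zero (d : Order.disp_t) (W : orderType d) (a : W) : Prop :=
  forall b : W, (a <= b)%O.

Definition is_succ (d : Order.disp_t) (W : orderType d) (b a : W) : Prop :=
  (b < a)%O /\ (forall c : W, (b < c)%O -> (a <= c)%O).

Definition is_limit (d : Order.disp_t) (W : orderType d) (a : W) : Prop :=
  ~ is_zero a /\ ~ (exists b : W, is_succ b a).

Definition well_ordered (d : Order.disp_t) (W : orderType d) : Prop :=
  well_founded (fun a b : W => (a < b)%O).

(* Ordinals are the elements of an arbitrary well-order W. [rank_ge step] is
   given by the recursion
     rank >= 0     always,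
     rank >= b + 1 iff [step] holds of the set {rank >= b},
     rank >= a     iff rank >= b for all b < a   (a limit);
   see the three lemmas below. *)
Definition rank_ge (d : Order.disp_t) (W : orderType d) (wfW : well_ordered W)
    (X : Type) (step : set X -> set X) : W -> set X :=
  Fix wfW (fun _ => set X) (fun a rec => [set p |
    (forall (b : W) (ba : (b < a)%O), is_succ b a -> step (rec b ba) p) /\
    (is_limit a -> forall (b : W) (ba : (b < a)%O), rec b ba p)]).

(* The supremum of the a with rank >= a, or infinity (None) if there is no
   supremum. In a well-order W the value is an ordinal cut off at the length
   of W; it is the true one as soon as W has no last element and more elements
   than there are objects to be ranked. *)
Definition rank (d : Order.disp_t) (W : orderType d) (wfW : well_ordered W)
    (X : Type) (step : set X -> set X) (p : X) : option W :=
  xget None (Some @` supremums [set a : W | rank_ge wfW step a p]).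

Lemma rank_geE (d : Order.disp_t) (W : orderType d) (wfW : well_ordered W)
    (X : Type) (step : set X -> set X) (a : W) (p : X) :
  rank_ge wfW step a p <->
  (forall b : W, (b < a)%O -> is_succ b a -> step (rank_ge wfW step b) p) /\
  (is_limit a -> forall b : W, (b < a)%O -> rank_ge wfW step b p).
Proof.
rewrite {1}/rank_ge Fix_eq // => c f g fg.
by congr (_ : set X); apply/funext => q; congr (_ /\ _); apply/propext;
  split=> H; move=> *; [rewrite -fg|rewrite fg|rewrite -fg|rewrite fg]; exact: H.
Qed.

Lemma rank_ge_zero (d : Order.disp_t) (W : orderType d)
    (wfW : well_ordered W) (X : Type) (step : set X -> set X) (a : W) (p : X) :
  is_zero a -> rank_ge wfW step a p.
Proof.
move=> a0; apply/rank_geE; split=> [b ba _|[]//].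
by move: ba; rewrite ltNge a0.
Qed.

Lemma rank_ge_succ (d : Order.disp_t) (W : orderType d)
    (wfW : well_ordered W) (X : Type) (step : set X -> set X) (b a : W)
    (p : X) :
  is_succ b a ->
  (rank_ge wfW step a p <-> step (rank_ge wfW step b) p).
Proof.
move=> ba; split=> [/rank_geE[H _]|H]; first by apply: H; [case: ba|].
apply/rank_geE; split=> [c ca [_ cP]|[_ []]]; last by exists b.
suff -> : c = b by [].
case: ba => [ba bP]; case: (ltgtP c b) => // [/cP|/bP].
  by rewrite leNgt ba.
by rewrite leNgt ca.
Qed.

Lemma rank_ge_limit (d : Order.disp_t) (W : orderType d)
    (wfW : well_ordered W) (X : Type) (step : set X -> set X) (a : W) (p : X) :
  is_limit a ->
  (rank_ge wfW step a p <-> forall b : W, (b < a)%O -> rank_ge wfW step b p).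
Proof.
move=> la; split=> [/rank_geE[_]|H]; first exact.
by apply/rank_geE; split=> // b _ ba; case: la => _ []; exists b.
Qed.

(* In both steps G is {SU^d >= alpha}; the step gives {SU^d >= alpha + 1}. *)
Definition SUd_step (K : Type) (L : language) (M : structure L) (n : nat)
    (G : set (ctype K M n)) : set (ctype K M n) :=
  [set p : ctype K M n | exists q, Rd p q /\ G q].

Definition SUd'_step (K : Type) (L : language) (M : structure L) (n : nat)
    (G : set (ctype K M n)) : set (ctype K M n) :=
  [set p : ctype K M n | exists (k : nat) (lambda : set K), [/\ 2 <= k, small K lambda &
    forall kappa : set K, small K kappa ->
      exists C : set (ctype K M n), [/\ C #= kappa,
        k_inconsistent k C (fun q => fml q) &
        forall q, C q -> [/\ p `<=` q, dom q #<= lambda & G q]]]].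

(* Main.v *)
(* Rank by rank it suffices to compare the two successor steps, where
   G = {SU^d >= alpha} is invariant under automorphisms of M.

   If q divides over A = dom p through phi(x, b), compactness stretches the
   k-inconsistent sequence of conjugates of phi(x, b) to any small length.
   Automorphisms over A carrying b to the members of the new sequence carry q to
   conjugates of q; since k members of the sequence are never satisfied together,
   each conjugate is repeated fewer than k times, so that there are as many of
   them as desired.

   Conversely, enumerate the domains of the members of a very large
   k-inconsistent family by a common index set, together with A. Colour each
   k-subset of the family by a formula witnessing its inconsistency. There are
   few colours, as the domains are bounded by lambda, so the Erdos-Rado theorem
   yields an infinite homogeneous sequence. Its members are conjugate over A and
   share a single witness phi; hence each of them divides over A through phi. *)

From Stdlib Require List.
From mathcomp Require Import all_boot all_order.
From mathcomp Require Import wochoice.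
From mathcomp Require Import all_classical.
(* last, because the [fmap] of filters would shadow that of formulas *)
Require Import Defs.

Set Implicit Arguments.
Unset Strict Implicit.
Unset Printing Implicit Defensive.

Local Open Scope classical_set_scope.
Local Open Scope card_scope.

(** * Cardinals *)

Definition embeds (X Y : Type) : Prop := exists f : X -> Y, injective f.

Lemma embeds_refl X : embeds X X.
Proof. by exists id. Qed.

Lemma embeds_trans X Y Z : embeds X Y -> embeds Y Z -> embeds X Z.
Proof. by move=> [f fI] [g gI]; exists (g \o f); exact: inj_comp. Qed.

Lemma embeds_surj X Y (f : X -> Y) : (forall y, exists x, f x = y) -> embeds Y X.
Proof.
move=> /choice[g gK]; exists g => y y' e.
by rewrite -(gK y) e gK.
Qed.

Lemma cantor X : ~ embeds (set X) X.
Proof.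
move=> [f fI]; pose D := [set x | exists2 A, f A = x & ~ A x].
have [DD|nDD] := pselect (D (f D)); last by apply: (nDD); exists D.
by case: (DD) => A /fI -> /(_ DD).
Qed.

(** A maximal partial injection, given by Zorn's lemma, is total or onto: otherwise one more pair
    could be added. *)
Lemma embeds_total X Y : embeds X Y \/ embeds Y X.
Proof.
(* One equivalence says both that [G] is single-valued and that it is injective. *)
pose P := [set G : set (X * Y) |
  forall u v, G u -> G v -> (u.1 = v.1 <-> u.2 = v.2)].
have [F FP Ftot|G [PG Gmax]] := @Zorn_bigcup _ P.
  move=> u v [A FA Au] [B FB Bv].
  by have [AB|BA] := Ftot _ _ FA FB; [apply: (FP B FB)|apply: (FP A FA)]; auto.
have [dX|/existsNP[x xG]] := pselect (forall x, exists y, G (x, y)).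
  left; have [f fG] := choice dX; exists f => x x' e.
  exact: (PG _ _ (fG x) (fG x')).2.
have [dY|/existsNP[y yG]] := pselect (forall y, exists x, G (x, y)).
  right; have [f fG] := choice dY; exists f => y y' e.
  exact: (PG _ _ (fG y) (fG y')).1.
exfalso; apply: (Gmax (G `|` [set (x, y)])).
  split; first by move=> u; left.
  by move=> /(_ (x, y)) H; apply: xG; exists y; apply: H; right.
move=> [a b] [a' b'] /= [Gu|[-> ->]] [Gv|[-> ->]] //=.
- exact: (PG _ _ Gu Gv).
- by split=> e; [case: xG; exists b|case: yG; exists a]; rewrite -e.
- by split=> e; [case: xG; exists b'|case: yG; exists a']; rewrite e.
Qed.

(** * Strict well-orders *)

Definition strict_wo (X : Type) (lt : X -> X -> Prop) : Prop :=
  [/\ well_founded lt, (forall x y z, lt x y -> lt y z -> lt x z) &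
      forall x y, [\/ lt x y, x = y | lt y x]].

Lemma wf_irr X (lt : X -> X -> Prop) : well_founded lt -> forall x, ~ lt x x.
Proof. by move=> wf x; elim: (wf x) => {}x _ IH xx; exact: (IH x xx xx). Qed.

Lemma strict_wo_exists (X : Type) : exists lt : X -> X -> Prop, strict_wo lt.
Proof.
have [R Rwo] := well_ordering_principle {classic X}.
have Rc : wo_chain R predT by move=> A _; exact: Rwo.
have Rtot (x y : {classic X}) : R x y || R y x by apply: (wo_chainW Rc).
have Ranti (x y : {classic X}) : R x y -> R y x -> x = y.
  by move=> xy yx; apply: (wo_chain_antisymmetric Rc) => //; rewrite xy.
have Rmin (A : set X) : A !=set0 -> exists2 z, A z & forall y, A y -> R z y.
  move=> [x Ax]; have [|z [[/asboolP Az zP] _]] := Rwo (fun x => `[< A x >]).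
    by exists x; apply/asboolP.
  by exists z => // y Ay; apply: zP; apply/asboolP.
(* Transitivity comes from the least element of [[set x; y; z]], together with antisymmetry. *)
have Rtr (x y z : X) : R x y -> R y z -> R x z.
  move=> xy yz; have [|w] := Rmin [set x; y; z]; first by exists x; left; left.
  move=> [[->|->]|->] wP.
  - by apply: wP; right.
  - have yx : R y x by apply: wP; left; left.
    by rewrite (Ranti _ _ xy yx).
  - have zy : R z y by apply: wP; left; right.
    by rewrite -(Ranti _ _ yz zy).
exists (fun x y => R x y /\ x <> y); split.
- move=> x; apply: contrapT => nx.
  have [|z zA zP] := Rmin [set y | ~ Acc (fun x y => R x y /\ x <> y) y].
    by exists x.
  apply: zA; constructor => y [yz ne]; apply: contrapT => /zP zy.
  by apply: ne; exact: Ranti.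
- move=> x y z [xy nxy] [yz nyz]; split; first exact: Rtr xy yz.
  by move=> e; subst z; apply: nxy; exact: Ranti.
- move=> x y; have [e|ne] := pselect (x = y); first by constructor 2.
  have /orP[H|H] := Rtot x y; [constructor 1|constructor 3]; split=> //.
  by move=> e; apply: ne.
Qed.

Lemma wf_min X (lt : X -> X -> Prop) (A : set X) : strict_wo lt -> A !=set0 ->
  exists2 z, A z & forall y, A y -> y = z \/ lt z y.
Proof.
move=> [wf _ tot] [x Ax]; apply: contrapT => H.
elim: (wf x) Ax => {}x _ IH Ax; apply: H; exists x => // y Ay.
by case: (tot x y) => [|->|/IH]; [right|left|].
Qed.

Lemma card_leE T U (A : set T) (B : set U) : (A #<= B) <-> embeds A B.
Proof.
split=> [/card_leP/injfunPex[f _ fI]|[f fI]].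
  by exists f => x y e; apply: fI => //; exact: in_setT.
by apply/card_leP/injfunPex; exists f => // x y _ _; exact: fI.
Qed.

Lemma card_leTE (T U : Type) : ([set: T] #<= [set: U]) <-> embeds T U.
Proof.
split=> [/card_leE[f fI]|[f fI]].
  exists (fun x => val (f (SigSub (in_setT x)))) => x y /val_inj/fI.
  by move=> /(congr1 val).
apply/card_leE; exists (fun x => SigSub (in_setT (f (val x)))) => x y.
by move=> /(congr1 val)/fI/val_inj.
Qed.

(** These are Kuratowski pairs; they bound a product by two power sets, which a strong limit
    absorbs. *)
Lemma embeds_pair Y : embeds (Y * Y) (set (set Y)).
Proof.
exists (fun p => [set [set p.1]; [set p.1; p.2]]) => -[a b] [a' b'] /= e.
have aa' : a' = a.
  have : [set [set a']; [set a'; b']] [set a] by rewrite -e; left.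
  by case=> e1; [have : [set a] a' by rewrite e1|
                 have : [set a] a' by rewrite e1; left].
subst a'; congr (_, _).
have : [set [set a]; [set a; b']] [set a; b] by rewrite -e; right.
have : [set [set a]; [set a; b]] [set a; b'] by rewrite e; right.
move=> h1 h2.
have b'P : b' = a \/ b' = b.
  by case: h1 => e1; [left; have : [set a] b' by rewrite -e1; right|
     have : [set a; b] b' by rewrite -e1; right].
have bP : b = a \/ b = b'.
  by case: h2 => e1; [left; have : [set a] b by rewrite -e1; right|
     have : [set a; b'] b by rewrite -e1; right].
by case: b'P; case: bP; congruence.
Qed.

(** The form of [small] for types: as cardinals are comparable, it means |X| < |K|. *)
Definition smallT (K X : Type) : Prop := ~ embeds K X.

Lemma smallE (K T : Type) (X : set T) : small K X <-> smallT K X.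
Proof.
have KT : embeds K [set: K].
  by exists (fun x => SigSub (in_setT x)) => x y /(congr1 val).
have TK : embeds [set: K] K by exists val; exact: val_inj.
split=> H H'; apply: H.
  by apply/card_leE; exact: embeds_trans TK H'.
by apply: embeds_trans KT _; apply/card_leE.
Qed.

Lemma smallTE (K X : Type) : small K [set: X] <-> smallT K X.
Proof. by split=> H H'; apply: H; apply/card_leTE. Qed.

Lemma smallT_le K X Y : embeds X Y -> smallT K Y -> smallT K X.
Proof. by move=> XY KY KX; apply: KY; exact: embeds_trans KX XY. Qed.

Lemma smallT_embeds K X : smallT K X -> embeds X K.
Proof. by case: (embeds_total X K). Qed.

(** The cardinals in [SUd'_step] are subsets of [K]; this turns a small type into one. *)
Lemma small_realize K X : smallT K X ->
  exists (S : set K) (f : X -> K), [/\ small K S, injective f & S = range f].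
Proof.
move=> KX; have [f fI] := smallT_embeds KX.
exists (range f), f; split=> //; apply/smallE; apply: smallT_le KX.
have /choice[g gK] : forall s : range f, exists x, f x = val s.
  by move=> [s /= /set_mem[x _ xs]]; exists x.
by exists g => s s' e; apply: val_inj; rewrite -!gK e.
Qed.

(** * Closure of the small cardinals under the usual operations, for an uncountable strong limit *)

Section SmallCardinals.
Variable K : Type.
Hypothesis Kpow :
  forall X : set K, small K X -> small K [set Y : set K | Y `<=` X].
Hypothesis Knat : smallT K nat.

Lemma smallT_set X : smallT K X -> smallT K (set X).
Proof.
move=> /small_realize[S [f [KS fI SE]]].
apply: smallT_le ((smallE _ _).1 (Kpow KS)).
have sub (A : set X) : f @` A \in [set Y | Y `<=` S].
  by apply/mem_set; rewrite SE => _ [x _ <-]; exists x.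
exists (fun A => SigSub (sub A)) => A B /(congr1 val)/= e.
by apply/seteqP; split=> x Ax; [have : (f @` B) (f x) by rewrite -e; exists x|
  have : (f @` A) (f x) by rewrite e; exists x]; case=> y ? /fI <-.
Qed.

Lemma smallT_prod X Y : smallT K X -> smallT K Y -> smallT K (X * Y).
Proof.
wlog XY : X Y / embeds X Y => [H kX kY|kX kY].
  have [|YX] := embeds_total X Y; first by move=> XY; exact: H.
  have := H _ _ YX kY kX; apply: smallT_le.
  by exists (fun p => (p.2, p.1)) => -[a b] [c d] [-> ->].
apply: (@smallT_le _ _ (set (set Y))); last by do 2! apply: smallT_set.
apply: embeds_trans (embeds_pair Y); case: XY => f fI.
by exists (fun p => (f p.1, p.2)) => -[a b] [c d] [/fI -> ->].
Qed.

Lemma smallT_sum X Y : smallT K X -> smallT K Y -> smallT K (X + Y).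
Proof.
move=> kX kY; apply: (@smallT_le _ _ (set X * set Y)); last first.
  by apply: smallT_prod; exact: smallT_set.
exists (fun s => match s with
  | inl x => ([set x], set0) | inr y => (set0, [set y]) end).
move=> [x|y] [x'|y'] /=.
- by case=> e; have <- : x = x' by have : [set x'] x by rewrite -e.
- by case=> e _; have : (@set0 X) x by rewrite -e.
- by case=> _ e; have : (@set0 Y) y by rewrite -e.
- by case=> e; have <- : y = y' by have : [set y'] y by rewrite -e.
Qed.

Lemma smallT_seq X : smallT K X -> smallT K (seq X).
Proof.
move=> kX; apply: (@smallT_le _ _ (set (nat * X))); last first.
  by apply: smallT_set; exact: smallT_prod.
exists (fun s => [set p | onth s p.1 = Some p.2]) => s s' e.
have {}e i x : onth s i = Some x <-> onth s' i = Some x.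
  by have := congr1 (fun A => A (i, x)) e => /= ->.
elim: s s' e => [|x s IH] [|y s'] e //.
- by have := (e 0 y).2 erefl.
- by have := (e 0 x).1 erefl.
congr (_ :: _); first by have [] := (e 0 x).1 erefl.
by apply: IH => i z; exact: (e i.+1 z).
Qed.

Lemma smallT_option X : smallT K X -> smallT K (option X).
Proof.
move=> kX; apply: (@smallT_le _ _ (seq X)); last exact: smallT_seq.
by exists (fun o => if o is Some x then [:: x] else [::]) => -[x|] [y|] // [->].
Qed.

End SmallCardinals.

(** * The Erdos-Rado theorem *)

(** Take repeatedly the index of the least remaining value: by injectivity all later values are
    strictly larger. *)
Lemma increasing_subseq X (lt : X -> X -> Prop) (f : nat -> X) :
  strict_wo lt -> injective f ->
  exists h : nat -> X, forall i j, i < j -> lt (h i) (h j).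
Proof.
move=> lto fI; have [wf tr tot] := lto.
have /choice[g gP] : forall N, exists n, N <= n /\
    forall m, N <= m -> m = n \/ lt (f n) (f m).
  move=> N; have [|_ [n Nn <-] nP] := @wf_min _ _ (f @` [set m | N <= m]) lto.
    by exists (f N), N => //=.
  exists n; split=> // m Nm.
  by case: (nP (f m)) => [|/fI|]; [exists m|left|right].
pose u := fix u i := if i is i'.+1 then g (u i').+1 else g 0.
exists (f \o u); apply: homo_ltn => [y x z|i]; first exact: tr.
have [M [Mu uM]] : exists M, M <= u i /\
    forall m, M <= m -> m = u i \/ lt (f (u i)) (f m).
  by case: i => [|i] /=; [exists 0|exists (u i).+1]; apply: gP.
have lt_u : u i < u i.+1 by case: (gP (u i).+1).
case: (uM (u i.+1)) => [|e|//]; first exact: leq_trans (ltnW lt_u).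
by rewrite e ltnn in lt_u.
Qed.

Lemma strict_wo_sub X (lt : X -> X -> Prop) (P : X -> Prop) : strict_wo lt ->
  strict_wo (fun a b : {x | P x} => lt (sval a) (sval b)).
Proof.
move=> [wf tr tot]; split=> [a|a b c|a b]; last 2 first.
- exact: tr.
- case: (tot (sval a) (sval b)) => H;
    [constructor 1|constructor 2|constructor 3] => //.
  by case: a b H => [a pa] [b pb] /= e; exact: eq_exist.
move: {-1}(sval a) (erefl (sval a)) => x.
elim: (wf x) a => {}x _ IH a ax; constructor => b ba.
by apply: (IH (sval b)) => //; rewrite -ax.
Qed.

Lemma in_map_inj X Y (f : X -> Y) (D : set X) (s t : seq X) :
  (forall x y, D x -> D y -> f x = f y -> x = y) ->
  (forall z, List.In z s -> D z) -> (forall z, List.In z t -> D z) ->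
  map f s = map f t -> s = t.
Proof.
move=> fI; elim: s t => [|x s IH] [|y t] //= Ds Dt [fxy].
move=> /IH->; [|by move=> z zs; apply: Ds; right|by move=> z zs; apply: Dt; right].
by rewrite (fI x y) //; [apply: Ds; left|apply: Dt; left].
Qed.

(** * End-homogeneous sets and their codes *)

Section EndHomogeneous.
Variables (X Y : Type) (lt : X -> X -> Prop) (c : seq X -> Y).
Hypothesis lto : strict_wo lt.

(* The greedily chosen set of elements below [x] on which the colour of a
   sequence does not change when its last entry is replaced by [x]. *)
Definition endhom (x : X) : X -> Prop :=
  Fix (let: And3 wf _ _ := lto in wf) (fun _ => Prop) (fun y rec =>
    lt y x /\ forall s, (forall z, List.In z s -> exists H : lt z y, rec z H) ->
      c (rcons s y) = c (rcons s x)).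

Lemma endhomE x y : endhom x y <-> lt y x /\ forall s,
  (forall z, List.In z s -> lt z y /\ endhom x z) ->
  c (rcons s y) = c (rcons s x).
Proof.
rewrite {1}/endhom Fix_eq => [|a f g fg].
  split=> -[yx H]; split=> // s sP; apply: H => z /sP.
    by case=> zy ez; exists zy.
  by case=> zy ez.
congr (_ /\ _); apply/propext; split=> H s sP; apply: H => z /sP[za fz];
  exists za; [by rewrite fg|by rewrite -fg].
Qed.

Section Code.
Variables (O : Type) (j : X -> X -> O).
Hypothesis jI : forall x a b, endhom x a -> endhom x b -> j x a = j x b -> a = b.

(* [x] can be recovered from the order on [endhom x] and the colours of the
   sequences ending with [x], read through the injection [j x] into [O]. *)
Definition endhom_code (x : X) : set (O * O) * set (seq O * Y) :=
  ([set p | exists a b, [/\ endhom x a, endhom x b, (a = b \/ lt a b) &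
      p = (j x a, j x b)]],
   [set p | exists s, (forall z, List.In z s -> endhom x z) /\
      p = (map (j x) s, c (rcons s x))]).

Definition agree x y a :=
  (endhom x a <-> endhom y a) /\ (endhom x a -> j x a = j y a).

(** The code of [x] records the colour under the labels of [s]. As [x] and [y] label [s] alike and
    labels are injective, only [s] itself can provide this entry in the code of [y]. *)
Lemma code_color x y s : endhom_code x = endhom_code y ->
  (forall z, List.In z s -> agree x y z /\ endhom x z) ->
  c (rcons s x) = c (rcons s y).
Proof.
move=> e sP.
have : (endhom_code y).2 (map (j x) s, c (rcons s x)).
  by rewrite -e; exists s; split=> // z /sP[].
have -> : map (j x) s = map (j y) s.
  elim: s sP => //= z s IH sP; rewrite IH; last by move=> w ws; apply: sP; right.
  by have [|[_ jz] xz] := sP z; [left|rewrite jz].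
move=> [t [tP [est ->]]]; suff -> : s = t by [].
apply: (in_map_inj (D := endhom y)) est => //; first exact: jI.
by move=> z /sP[[zz _]] /zz.
Qed.

(** The element [b] of [endhom y] with the label of [a] must be [a]: otherwise the smaller of the
    two would satisfy the defining condition of the other set and belong to both sets, which labels
    and order exclude. *)
Lemma code_agree x y a : endhom_code x = endhom_code y ->
  (forall b, lt b a -> agree x y b) -> endhom x a ->
  endhom y a /\ j x a = j y a.
Proof.
have [wf tr tot] := lto; have irr := wf_irr wf.
move=> e IH xa.
have [b yb jb] : exists2 b, endhom y b & j y b = j x a.
  have : (endhom_code y).1 (j x a, j x a).
    by rewrite -e; exists a, a; split=> //; left.
  by case=> b [b' [yb _ _ [jb _]]]; exists b.
(* The order part of the code matches the members of [endhom y] below [b] with members of [endhom x]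
   below [a]; the hypothesis on smaller elements identifies the two. *)
have P2 b' : endhom y b' -> lt b' b -> lt b' a /\ endhom x b'.
  move=> yb' b'b; have : (endhom_code x).1 (j y b', j y b).
    by rewrite e; exists b', b; split=> //; right.
  case=> u [v [xu xv uv [ju jv]]].
  have va : v = a by apply: (jI xv xa); rewrite -jv.
  subst v; case: uv => [ua|ua].
    by subst u; case: (irr b); rewrite -{1}(jI yb' yb) // ju -jb.
  have [uu uj] := IH _ ua.
  have <- : u = b' by apply: (jI (uu.1 xu) yb'); rewrite -uj.
  by [].
case: (tot a b) => [ab|ab|ba]; last 2 first.
- by subst b.
- suff xb : endhom x b.
    have [_ jxy] := IH _ ba; case: (irr b); rewrite {2}(jI xb xa) //.
    by rewrite -jb jxy.
  apply/endhomE; split; first by apply: tr ba _; case/endhomE: xa.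
  move=> s sP; have sa z : List.In z s -> agree x y z /\ endhom x z.
    by move=> /sP[zb xz]; split=> //; apply: IH; exact: tr zb ba.
  rewrite (code_color e sa); case/endhomE: yb => _; apply=> z zs.
  by case: (sa z zs) => -[zz _] /zz yz; case: (sP z zs).
- suff ya : endhom y a by have [/irr] := P2 _ ya ab.
  apply/endhomE; split; first by apply: tr ab _; case/endhomE: yb.
  move=> s sP; have sa z : List.In z s -> agree x y z /\ endhom x z.
    by move=> /sP[za yz]; have A := IH _ za; split=> //; case: A => zz _; exact/zz.
  rewrite -(code_color e sa); case/endhomE: xa => _; apply=> z zs.
  by case: (sa z zs) => _ xz; case: (sP z zs).
Qed.
End Code.

(** Equal codes give equal sets, by induction along [lt]. If moreover [x] were below [y], then [x]
    would qualify for [endhom y], hence lie in [endhom x], whose members are strictly below [x]. *)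
Lemma endhom_code_inj O (j : X -> X -> O) :
  (forall x a b, endhom x a -> endhom x b -> j x a = j x b -> a = b) ->
  injective (endhom_code j).
Proof.
move=> jI; have [wf tr tot] := lto; have irr := wf_irr wf.
have nlt x y : endhom_code j x = endhom_code j y -> ~ lt x y.
  move=> e xy; have agr a : agree j x y a.
    elim: (wf a) => {}a _ IH; split; last by move=> /(code_agree jI e IH)[].
    split; first by move=> /(code_agree jI e IH)[].
    suff IH' b : lt b a -> agree j y x b.
      by move=> /(code_agree jI (esym e) IH')[].
    by move=> /IH[h1 h2]; split; [exact: iff_sym|move=> /h1/h2->].
  suff yx : endhom y x by have /endhomE[/irr] := (agr x).1.2 yx.
  apply/endhomE; split=> // s sP; apply: (code_color jI e) => z /sP[_ yz].
  by split; [exact: agr|case: (agr z) => zz _; exact/zz].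
move=> x y e; case: (tot x y) => // h; first by have := nlt _ _ e h.
by have := nlt _ _ (esym e) h.
Qed.

End EndHomogeneous.

Section ErdosRado.
Variable K : Type.
Hypothesis Kpow :
  forall X : set K, small K X -> small K [set Y : set K | Y `<=` X].
Hypothesis Knat : smallT K nat.

(* If some set of end-homogeneous predecessors is large, the colour of a
   sequence in it does not depend on its last entry and induction applies;
   otherwise the codes give an injection of [X] into a smaller set. *)
Lemma erdos_rado (k : nat) (Y : Type) : smallT K Y ->
  exists Z : Type, smallT K Z /\
    forall (X : Type) (lt : X -> X -> Prop) (c : seq X -> Y),
      strict_wo lt -> embeds Z X ->
      exists h : nat -> X, (forall i j, i < j -> lt (h i) (h j)) /\
        exists y, forall s : seq nat, size s = k -> sorted ltn s ->
          c (map h s) = y.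
Proof.
move=> kY; elim: k => [|k [Z [kZ IH]]].
  exists nat; split=> // X lt c lto [f /(increasing_subseq lto)[h hP]].
  by exists h; split=> //; exists (c [::]) => -[].
pose O := option Z; pose code := (set (O * O) * set (seq O * Y))%type.
have kO : smallT K O by exact: smallT_option.
(* By Cantor's theorem a set of this size cannot be embedded into [code]. *)
exists (set code); split.
  apply: smallT_set => //; apply: smallT_prod => //; apply: smallT_set => //;
    apply: smallT_prod => //.
  exact: smallT_seq.
move=> X lt c lto ZX.
have [[x Zx]|/forallNP nZ] :=
    pselect (exists x, embeds Z {y | endhom c lto x y}).
  have lto' := strict_wo_sub (endhom c lto x) lto.
  (* Appending [x] turns the colouring into one of sequences of length [k]; replacing [x] by a later
     term of [h] then leaves the colour unchanged. *)
  have [h [hlt [y hy]]] := IH _ _ (fun s => c (rcons (map sval s) x)) lto' Zx.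
  exists (fun i => sval (h i)); split; first by move=> i l /hlt.
  exists y => s; case/lastP: s => // s i; rewrite size_rcons => -[ss].
  rewrite (sorted_pairwise ltn_trans) pairwise_rcons.
  rewrite -(sorted_pairwise ltn_trans) => /andP[/allP si srt].
  rewrite map_rcons -(hy s ss srt) -map_comp.
  have /endhomE[_ ->//] := svalP (h i) => z.
  elim: s si {ss srt} => //= a s IHs si [<-|zs]; last first.
    by apply: IHs => // b bs; apply: si; rewrite inE bs orbT.
  by split; [apply: hlt; apply: si; rewrite inE eqxx|exact: svalP].
exfalso; apply: (@cantor code); apply: embeds_trans ZX _.
have /choice[j jI] : forall x, exists f : X -> O, forall a b,
    endhom c lto x a -> endhom c lto x b -> f a = f b -> a = b.
  move=> x; case: (embeds_total Z {y | endhom c lto x y}) => [/nZ//|[f fI]].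
  exists (fun y => if pselect (endhom c lto x y) is left e
                   then Some (f (exist _ y e)) else None) => a b xa xb.
  by case: pselect => // xa'; case: pselect => // xb' [/fI[]].
by exists (endhom_code c lto j); exact: endhom_code_inj.
Qed.

End ErdosRado.

(** * Syntax and semantics *)

Lemma in_listP (T : eqType) (s : seq T) x : List.In x s <-> x \in s.
Proof.
elim: s => //= y s IH; rewrite inE; split=> [[->|/IH->]|/orP[/eqP->|/IH]].
- by rewrite eqxx.
- by rewrite orbT.
- by left.
- by right.
Qed.

Lemma finite_setList (T : Type) (A : set T) :
  finite_set A <-> exists s : seq T, forall x, A x <-> List.In x s.
Proof.
have := @finite_seqP {classic T} A; move=> ->; split=> -[s sP]; exists s.
  by rewrite sP => x; exact: iff_sym (@in_listP {classic T} s x).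
by apply/seteqP; split=> x /=;
  [move=> /sP/(@in_listP {classic T})|move=> /(@in_listP {classic T})/sP].
Qed.

Lemma in_mapP (X Y : Type) (f : X -> Y) s y :
  List.In y (map f s) <-> exists2 x, List.In x s & f x = y.
Proof.
elim: s => [|a s IH]; first by split=> // -[].
split=> [[<-|h]|[x [->|xs] fxy]].
- by exists a => //; left.
- by have [x xs <-] := IH.1 h; exists x => //; right.
- by left.
- by right; apply/IH; exists x.
Qed.

Definition sum_env (X W Z : Type) (x : X -> Z) (e : W -> Z) (v : X + W) : Z :=
  match v with inl i => x i | inr a => e a end.

Section Syntax.
Variable L : language.

Lemma fmap_comp V V' V'' k (f : V -> V') (g : V' -> V'') (phi : preformula L V k) :
  fmap g (fmap f phi) = fmap (g \o f) phi.
Proof.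
have tm j (t : term L V j) : tmap g (tmap f t) = tmap (g \o f) t.
  by elim: t => //= F args IH; congr App; apply/funext.
elim: phi => //= [j s t|j r args|j p -> q ->|j p ->] //.
  by rewrite !tm.
by congr Rel; apply/funext => i; rewrite tm.
Qed.

Lemma eq_fmap V V' k (f g : V -> V') (phi : preformula L V k) :
  (forall v, free phi v -> f v = g v) -> fmap f phi = fmap g phi.
Proof.
have tm j (t : term L V j) : (forall v, tfree t v -> f v = g v) ->
    tmap f t = tmap g t.
  elim: t => [v|i|F args IH] //= fg; first by rewrite fg.
  by congr App; apply/funext => i; apply: IH => v vi; apply: fg; exists i.
elim: phi => //= [j s t|j r args|j p IHp q IHq|j p IH] fg.
- by rewrite !tm // => v tv; apply: fg; [right|left].
- by congr Rel; apply/funext => i; apply: tm => v vi; apply: fg; exists i.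
- by rewrite IHp ?IHq // => v tv; apply: fg; [right|left].
- by rewrite IH.
Qed.

Lemma fmap_id V k (phi : preformula L V k) : fmap id phi = phi.
Proof.
have tm j (t : term L V j) : tmap id t = t.
  by elim: t => //= F args IH; congr App; apply/funext.
elim: phi => //= [j s t|j r args|j p -> q ->|j p ->] //.
  by rewrite !tm.
by congr Rel; apply/funext => i; rewrite tm.
Qed.

Lemma free_fmap V V' k (f : V -> V') (phi : preformula L V k) :
  free (fmap f phi) = f @` free phi.
Proof.
have bigim I (F : I -> set V) (G : I -> set V') : (forall i, G i = f @` F i) ->
    \bigcup_i G i = f @` \bigcup_i F i.
  move=> GF; rewrite image_bigcup; apply: eq_bigcup => // i _; exact: GF.
have tm j (t : term L V j) : tfree (tmap f t) = f @` tfree t.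
  elim: t => [v|i|F args IH] /=; [by rewrite image_set1|by rewrite image_set0|].
  exact: bigim.
elim: phi => //= [j|j s t|j r args|j p IHp q IHq].
- by rewrite image_set0.
- by rewrite image_setU !tm.
- by apply: bigim => i; exact: tm.
- by rewrite image_setU IHp IHq.
Qed.

(** This serves to trade the parameters of a formula for variables that name them. *)
Lemma fmap_onto V V' k (f : V -> V') (phi : preformula L V' k) :
  free phi `<=` range f -> exists psi : preformula L V k, fmap f psi = phi.
Proof.
have tm j (t : term L V' j) : tfree t `<=` range f ->
    exists t' : term L V j, tmap f t' = t.
  elim: t => [v|i|F args IH] /= tf.
  - by have [w _ <-] := tf v erefl; exists (FVar L _ w).
  - by exists (BVar _ _ i).
  - have /choice[a aP] : forall i, exists t' : term L V j, tmap f t' = args i.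
      by move=> i; apply: IH => v vi; apply: tf; exists i.
    by exists (App a) => /=; congr App; apply/funext.
elim: phi => [j|j s t|j r args|j p IHp q IHq|j p IHp] /= pf.
- by exists (Bot _ _ _).
- have [|s' <-] := tm _ s; first by move=> v vs; apply: pf; left.
  have [|t' <-] := tm _ t; first by move=> v vs; apply: pf; right.
  by exists (Eq s' t').
- have /choice[a aP] : forall i, exists t' : term L V j, tmap f t' = args i.
    by move=> i; apply: tm => v vi; apply: pf; exists i.
  by exists (Rel a) => /=; congr Rel; apply/funext.
- have [|s' <-] := IHp; first by move=> v vs; apply: pf; left.
  have [|t' <-] := IHq; first by move=> v vs; apply: pf; right.
  by exists (Imp s' t').
- by have [s' <-] := IHp pf; exists (All s').
Qed.

Lemma free_finite V k (phi : preformula L V k) : finite_set (free phi).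
Proof.
have bigf n (F : 'I_n -> set V) : (forall i, finite_set (F i)) ->
    finite_set (\bigcup_i F i).
  by move=> Ff; apply: bigcup_finite.
have tm j (t : term L V j) : finite_set (tfree t).
  elim: t => [v|i|F args IH] /=; last exact: bigf.
    exact: finite_set1.
  exact: finite_set0.
elim: phi => //= [j s t|j r args|j p IHp q IHq].
- by rewrite finite_setU; split.
- exact: bigf.
- by rewrite finite_setU; split.
Qed.

(* The variable [None] becomes a new outermost bound variable, whose de Bruijn
   index is the largest one. *)
Fixpoint tabs (W : Type) (k : nat) (t : term L (option W) k) : term L W k.+1 :=
  match t with
  | FVar v => if v is Some w then FVar L _ w else BVar _ _ ord_max
  | BVar i => BVar _ _ (widen_ord (leqnSn k) i)
  | App f args => App (fun i => tabs (args i))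
  end.

Fixpoint abs (W : Type) (k : nat) (phi : preformula L (option W) k) :
    preformula L W k.+1 :=
  match phi with
  | Bot k => Bot L W k.+1
  | Eq _ s t => Eq (tabs s) (tabs t)
  | Rel _ r args => Rel (fun i => tabs (args i))
  | Imp _ phi psi => Imp (abs phi) (abs psi)
  | All _ phi => All (abs phi)
  end.

Definition ex1 (W : Type) (phi : formula L (option W)) : formula L W :=
  Neg (All (Imp (abs phi) (Bot L W 1))).

Lemma free_abs W k (phi : preformula L (option W) k) w :
  free (abs phi) w -> free phi (Some w).
Proof.
have tm j (t : term L (option W) j) v : tfree (tabs t) v -> tfree t (Some v).
  elim: t => [[u|]|i|F args IH] //=; first by move=> ->.
  by move=> [i _ /IH]; exists i.
elim: phi => //= [j s t|j r args|j p IHp q IHq].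
- by move=> [/tm|/tm]; [left|right].
- by move=> [i _ /tm]; exists i.
- by move=> [/IHp|/IHq]; [left|right].
Qed.

Lemma free_ex1 W (phi : formula L (option W)) w :
  free (ex1 phi) w -> free phi (Some w).
Proof. by move=> [[h|[]]|[]]; exact: free_abs h. Qed.

Definition conjs (V : Type) (s : seq (formula L V)) : formula L V :=
  foldr (fun phi psi => Neg (Imp phi (Neg psi))) (Neg (Bot L V 0)) s.

Lemma fmap_conjs V V' (f : V -> V') s :
  fmap f (conjs s) = conjs (map (fmap f) s).
Proof. by elim: s => //= phi s IH; rewrite -[RHS]/(Neg (Imp _ (Neg _))) -IH. Qed.

Lemma free_conjs V (s : seq (formula L V)) v :
  free (conjs s) v -> exists2 phi, List.In phi s & free phi v.
Proof.
elim: s => [|phi s IH] /=; first by case.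
move=> [[phiv|[/IH[psi psis psiv]|[]]]|[]]; first by exists phi => //; left.
by exists psi => //; right.
Qed.

Lemma embeds_nat_formula : embeds nat (formula L nat).
Proof.
exists (fun n => Eq (FVar L 0 n) (FVar L 0 n)) => n m e.
have : free (Eq (FVar L 0 m) (FVar L 0 m)) n by rewrite -e; left.
by case.
Qed.

End Syntax.

Section Semantics.
Variables (L : language) (M : structure L).

Lemma presat_fmap V V' k (f : V -> V') (phi : preformula L V k) (e : V' -> M) h :
  presat e h (fmap f phi) <-> presat (e \o f) h phi.
Proof.
have tm j (t : term L V j) h' : teval e h' (tmap f t) = teval (e \o f) h' t.
  by elim: t => //= F args IH; congr fint; apply/funext.
elim: phi h => //= [j s t|j r args|j p IHp q IHq|j p IHp] h.
- by rewrite !tm.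
- by under eq_fun do rewrite tm.
- by rewrite IHp IHq.
- by split=> H a; apply/IHp.
Qed.

Lemma sat_fmap V V' (f : V -> V') (phi : formula L V) (e : V' -> M) :
  sat e (fmap f phi) <-> sat (e \o f) phi.
Proof. exact: presat_fmap. Qed.

Lemma presat_eq V k (phi : preformula L V k) (e e' : V -> M) h :
  (forall v, free phi v -> e v = e' v) -> presat e h phi -> presat e' h phi.
Proof.
have tm j (t : term L V j) h' : (forall v, tfree t v -> e v = e' v) ->
    teval e h' t = teval e' h' t.
  elim: t => [v|i|F args IH] //= fg; first by rewrite fg.
  by congr fint; apply/funext => i; apply: IH => v vi; apply: fg; exists i.
suff : (forall v, free phi v -> e v = e' v) ->
  presat e h phi <-> presat e' h phi by move=> H /H[].
elim: phi h => //= [j s t|j r args|j p IHp q IHq|j p IHp] h ee.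
- by rewrite !tm // => v tv; apply: ee; [right|left].
- have -> // : (fun i => teval e h (args i)) = (fun i => teval e' h (args i)).
  by apply/funext => i; apply: tm => v vi; apply: ee; exists i.
- by rewrite IHp ?IHq // => v tv; apply: ee; [right|left].
- by split=> H a; apply/IHp.
Qed.

Lemma sat_ext V (phi : formula L V) (e e' : V -> M) :
  (forall v, free phi v -> e v = e' v) -> sat e phi -> sat e' phi.
Proof. exact: presat_eq. Qed.

Lemma sat_eq V (phi : formula L V) (e e' : V -> M) :
  (forall v, free phi v -> e v = e' v) -> sat e phi <-> sat e' phi.
Proof. by move=> ee; split; apply: sat_ext => // v /ee. Qed.

Lemma presat_abs W k (phi : preformula L (option W) k) (e : W -> M)
    (h : 'I_k.+1 -> M) :
  presat e h (abs phi) <->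
  presat (oapp e (h ord_max)) (fun i => h (widen_ord (leqnSn k) i)) phi.
Proof.
have tm j (t : term L (option W) j) h' : teval e h' (tabs t) =
    teval (oapp e (h' ord_max)) (fun i => h' (widen_ord (leqnSn j) i)) t.
  by elim: t => [[v|]|i|F args IH] //=; congr fint; apply/funext.
elim: phi h => //= [j s t|j r args|j p IHp q IHq|j p IHp] h.
- by rewrite !tm.
- by under eq_fun do rewrite tm.
- by rewrite IHp IHq.
(* An inner quantifier adds an index at the low end, so the largest index still names the abstracted
   variable. *)
- have E a : presat e (fun i => oapp h a (unlift ord0 i)) (abs p) <->
    presat (oapp e (h ord_max))
      (fun i => oapp (fun i0 => h (widen_ord (leqnSn j) i0)) a (unlift ord0 i)) p.
    rewrite IHp.
    have -> : oapp h a (unlift ord0 (ord_max : 'I_j.+2)) = h ord_max.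
      have -> : ord_max = lift ord0 (ord_max : 'I_j.+1) by exact: val_inj.
      by rewrite liftK.
    suff -> : (fun i : 'I_j.+1 => oapp h a (unlift ord0 (widen_ord (leqnSn j.+1) i)))
      = (fun i => oapp (fun i0 => h (widen_ord (leqnSn j) i0)) a (unlift ord0 i)) by [].
    apply/funext => i; case: (unliftP ord0 i) => [i' ->|->].
      have -> : widen_ord (leqnSn j.+1) (lift ord0 i') =
        lift ord0 (widen_ord (leqnSn j) i') by exact: val_inj.
      by rewrite liftK.
    have -> : widen_ord (leqnSn j.+1) ord0 = ord0 by exact: val_inj.
    by rewrite unlift_none.
  by split=> H a; apply/E.
Qed.

Lemma satE V (phi : formula L V) (e : V -> M) (h : 'I_0 -> M) :
  sat e phi <-> presat e h phi.
Proof.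
have <- : (fun i : 'I_0 => match notF (ltn_ord i) with end) = h.
  by apply/funext => i; case: (notF (ltn_ord i)).
by [].
Qed.

Lemma sat_ex1 W (phi : formula L (option W)) (e : W -> M) :
  sat e (ex1 phi) <-> exists a, sat (oapp e a) phi.
Proof.
have E a h : presat e (fun i : 'I_1 => oapp h a (unlift ord0 i)) (abs phi) <->
    sat (oapp e a) phi.
  rewrite presat_abs -satE.
  have -> : ord_max = ord0 :> 'I_1 by exact: val_inj.
  by rewrite unlift_none.
split=> [H|[a Ha] H]; last by apply: (H a); apply/E.
by apply: contrapT => /forallNP nH; apply: H => a /E; exact: nH.
Qed.

Lemma sat_conjs V (s : seq (formula L V)) (e : V -> M) :
  sat e (conjs s) <-> forall phi, List.In phi s -> sat e phi.
Proof.
elim: s => [|phi s IH]; first by split=> // _ [].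
rewrite -[sat e _]/(~ (sat e phi -> ~ sat e (conjs s))); split.
  move=> H psi [<-|]; first by apply: contrapT => nphi; apply: H.
  move=> psis; suff /IH : sat e (conjs s) by apply.
  by apply: contrapT => nphi; apply: H.
move=> H; apply; first by apply: H; left.
by apply/IH => psi psis; apply: H; right.
Qed.

(** Injectivity of [s] handles equations and surjectivity handles quantifiers. *)
Lemma presat_aut (s : M -> M) : automorphism s ->
  forall V k (phi : preformula L V k) (e : V -> M) h,
  presat (s \o e) (s \o h) phi <-> presat e h phi.
Proof.
move=> [[s' sK s'K] sF sR] V k phi e.
have tm j (t : term L V j) h' : teval (s \o e) (s \o h') t = s (teval e h' t).
  elim: t => //= F args IH; rewrite sF; congr fint; exact/funext.
elim: phi => //= [j p q|j r args|j p IHp q IHq|j p IHp] h.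
- by rewrite !tm; split=> [/(can_inj sK)|->].
- by under eq_fun do rewrite tm; exact: sR.
- by rewrite IHp IHq.
- have E a : (fun i => oapp (s \o h) (s a) (unlift ord0 i)) =
    s \o (fun i : 'I_j.+1 => oapp h a (unlift ord0 i)).
    by apply/funext => i /=; case: unlift.
  split=> H a; first by apply/IHp; rewrite -E.
  by rewrite -[a]s'K E; apply/IHp.
Qed.

Lemma sat_aut (s : M -> M) V (phi : formula L V) (e : V -> M) : automorphism s ->
  sat (s \o e) phi <-> sat e phi.
Proof.
move=> sA; pose h (i : 'I_0) : M := match notF (ltn_ord i) with end.
by rewrite (satE phi e h) (satE phi (s \o e) (s \o h)); exact: presat_aut.
Qed.

End Semantics.

Lemma exn (L : language) n (W : Type) (phi : formula L ('I_n + W)) :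
  exists psi : formula L W, forall (M : structure L) (e : W -> M),
    sat e psi <-> exists x : 'I_n -> M, sat (sum_env x e) phi.
Proof.
elim: n W phi => [|n IH] W phi.
  exists (fmap (fun v : 'I_0 + W => match v with
    | inl i => match notF (ltn_ord i) with end | inr w => w end) phi) => M e.
  rewrite sat_fmap; split=> [H|[x]].
    exists (fun i : 'I_0 => match notF (ltn_ord i) with end); move: H.
    by apply: sat_ext => -[[]|].
  by apply: sat_ext => -[[]|].
(* The first variable becomes [None], the one that [ex1] binds; the others are shifted down. *)
pose f (v : 'I_n.+1 + W) : 'I_n + option W := match v with
  | inl i => if unlift ord0 i is Some i' then inl i' else inr None
  | inr w => inr (Some w) end.
have [psi psiP] := IH _ (fmap f phi); exists (ex1 psi) => M e.
rewrite sat_ex1; split=> [[a /psiP[x /sat_fmap H]]|[x H]].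
  exists (fun i => oapp x a (unlift ord0 i)); move: H.
  by apply: sat_ext => -[i|w] _ //=; case: unlift.
exists (x ord0); apply/psiP; exists (x \o lift ord0); apply/sat_fmap; move: H.
by apply: sat_ext => -[i|w] _ //=; case: unliftP => [i' ->|->].
Qed.

(** Finitely many variables occur in a formula, so it is given by a formula in the variables [nat]
    and a list of names for them; [v0] is the default entry. *)
Lemma smallT_formula (K : Type) (L : language) (V : Type) :
  sufficiently_large K L -> smallT K V -> inhabited V -> smallT K (formula L V).
Proof.
move=> [Kpow Kf] KV [v0].
have Kf' : smallT K (formula L nat) by apply/smallTE.
have Knat : smallT K nat by apply: smallT_le Kf'; exact: embeds_nat_formula.
apply: (@smallT_le _ _ (formula L nat * seq V)); last first.
  by apply: smallT_prod => //; exact: smallT_seq.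
apply: (@embeds_surj _ _ (fun p => fmap (nth v0 p.2) p.1)) => phi.
have /finite_setList[s sP] := free_finite phi.
have [|psi <-] := @fmap_onto L _ _ _ (nth v0 s) phi; last by exists (psi, s).
move=> v /sP; elim: s {sP} => //= a s IH [<-|/IH[i _ <-]]; first by exists 0.
by exists i.+1.
Qed.

(** * Realising types in small sets of variables *)

Lemma list_max (X : Type) (lt : X -> X -> Prop) (s : seq X) : strict_wo lt ->
  s = [::] \/ exists2 m, List.In m s & forall x, List.In x s -> x = m \/ lt x m.
Proof.
move=> [_ tr tot]; elim: s => [|a s IH]; [by left|right].
case: IH => [->|[m ms mP]]; first by exists a; [left|move=> x [->|[]]; left].
have [am|am|ma] := tot a m.
- exists m; first by right.
  by move=> x [<-|/mP//]; right.
- by subst a; exists m; [left|move=> x [->|/mP//]; left].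
- exists a; first by left.
  move=> x [->|/mP[->|xm]]; [by left|by right|right; exact: tr xm ma].
Qed.

Lemma list_lift (X Y : Type) (R : X -> Y -> Prop) (s : seq Y) :
  (forall y, List.In y s -> exists x, R x y) ->
  exists t : seq X, (forall x, List.In x t -> exists2 y, List.In y s & R x y) /\
    (forall y, List.In y s -> exists2 x, List.In x t & R x y).
Proof.
elim: s => [|y s IH] H; first by exists [::].
have [x xy] := H y (or_introl erefl).
have [|t [t1 t2]] := IH; first by move=> z zs; apply: H; right.
exists (x :: t); split=> [z [<-|/t1[w ws zw]]|z [<-|/t2[w wt wz]]].
- by exists y => //; left.
- by exists w => //; right.
- by exists x => //; left.
- by exists w => //; right.
Qed.

Section Realize.
Variables (K : Type) (L : language) (M : structure L) (V : Type) (A : set M).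
Hypotheses (Klarge : sufficiently_large K L) (Msat : saturated K M).
Hypotheses (KV : smallT K V) (KA : small K A).
Local Notation form := (formula L (V + M)).
Local Notation "e |= phi" := (sat (sum_env e id) phi) (at level 70).

Definition vars_in (D : set V) (phi : form) : Prop :=
  (forall v, free phi (inl v) -> D v) /\ (forall a, free phi (inr a) -> A a).

(** The values already given to [D] become parameters. What [U] says about [v] is then a complete
    1-type over a small set, and saturation realises it. *)
Lemma realize_step (U : set_system (V -> M)) (UF : UltraFilter U) (D : set V)
    (e : V -> M) (v : V) : ~ D v ->
  (forall psi, vars_in D psi -> U [set e | e |= psi] -> e |= psi) ->
  exists a : M, forall psi, vars_in (D `|` [set v]) psi ->
    U [set e | e |= psi] -> (fun w => if pselect (w = v) then a else e w) |= psi.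
Proof.
move=> Dv eD.
pose g (u : V + M) : 'I_1 + M := match u with
  | inl w => if pselect (w = v) then inl ord0 else inr (e w)
  | inr a => inr a end.
pose B := A `|` e @` D.
have KB : small K B.
  apply/smallE; apply: (@smallT_le _ _ (A + V)); last first.
    case: Klarge => Kpow Kf; apply: smallT_sum => //; last exact/smallE.
  have /choice[f fP] : forall b : B, exists u : A + V, match u with
      inl a => val a = val b | inr w => e w = val b end.
    move=> [b /= /set_mem[Ab|[w _ <-]]]; first by exists (inl (SigSub (mem_set Ab))).
    by exists (inr w).
  exists f => b b' eb; apply: val_inj; have := fP b; have := fP b'.
  by rewrite eb; case: (f b') => [a <-|w <-].
pose S := [set chi : pformula M 1 | exists psi,
  [/\ vars_in (D `|` [set v]) psi, U [set e | e |= psi] & fmap g psi = chi]].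
have [|x xP] := Msat KB (_ : complete_over B S); last first.
  exists (x ord0) => psi vpsi Upsi.
  have /sat_fmap : psat x (fmap g psi) by apply: xP; exists psi.
  by apply: sat_ext => -[w|b] _ //=; case: pselect.
split.
- move=> _ [psi [[p1 p2] _ <-]] b; rewrite free_fmap => -[[w /p1 wD|c /p2 Ac]] /=.
    by case: pselect => //= wv [<-]; right; exists w => //; case: wD.
  by case=> <-; left.
- move=> F /finite_setList[s sF] FS.
  have [|t [t1 t2]] := @list_lift _ _ (fun psi chi =>
      [/\ vars_in (D `|` [set v]) psi, U [set e | e |= psi] & fmap g psi = chi]) s.
    by move=> chi /sF/FS.
  pose k (u : V + M) : option (V + M) := match u with
    | inl w => if pselect (w = v) then None else Some u
    | inr a => Some u end.
  (* Finite satisfiability: that some value of [v] satisfies the conjunction is a statement about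
     [D] only; it holds on a set in [U], hence under [e]. *)
  have hex : e |= ex1 (fmap k (conjs t)); first apply: eD.
  + split=> [w|b] hf; have := free_ex1 hf; rewrite free_fmap => -[u hu ku];
      have [psi psit fu] := free_conjs hu; clear hu;
      have [chi _ [[p1 p2] _ _]] := t1 _ psit.
      case: u fu ku => //= w'; case: pselect => // w'v /p1 wD [<-].
      by case: wD.
    case: u fu ku => [w'|c] //=; first by case: pselect.
    by move=> /p2 Ac [<-].
  + have : U [set e | e |= conjs t].
      elim: t t1 {t2} => [|psi t IH] t1.
        by apply: filterS (@filterT _ U _) => e' _; apply/sat_conjs => phi [].
      have Upsi : U [set e | e |= psi].
        by have [|chi _ []] := t1 psi; first by left.
      have Ut : U [set e | e |= conjs t].
        by apply: IH => psi' h; apply: t1; right.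
      apply: filterS (filterI Upsi Ut) => e' [h1 /sat_conjs h2].
      by apply/sat_conjs => psi' [<-//|]; exact: h2.
    apply: filterS => e' h; apply/sat_ex1; exists (e' v); apply/sat_fmap.
    by apply: sat_ext h => -[w|b] _ //=; case: pselect => //= ->.
  + have [a /sat_fmap/sat_conjs aP] := (sat_ex1 _ _).1 hex.
    exists (fun=> a) => chi /sF/t2[psi psit [_ _ <-]]; apply/sat_fmap.
    by apply: sat_ext (aP _ psit) => -[w|b] _ //=; case: pselect.
- move=> chi chiB.
  (* Completeness: each parameter of [chi] lies in [A] or is the value of a variable in [D], so
     [chi] comes from a formula that [U] decides. *)
  have /choice[h hP] : forall u : 'I_1 + M, exists u' : V + M, free chi u ->
      g u' = u /\ match u' with inl w => (D `|` [set v]) w | inr b => A b end.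
    case=> [i|b].
      exists (inl v) => _ /=; split; last by right.
      by case: pselect => //= ?; rewrite (ord1 i).
    have [fb|nfb] := pselect (free chi (inr b)); last by exists (inr b).
    have [Ab|[w Dw <-]] := chiB _ fb; first by exists (inr b).
    exists (inl w) => _ /=; split; last by left.
    by case: pselect => //= wv; subst w.
  have hv : vars_in (D `|` [set v]) (fmap h chi).
    by split=> [w|b]; rewrite free_fmap => -[u /hP[_ +]] hu; rewrite hu.
  have gh : fmap g (fmap h chi) = chi.
    rewrite fmap_comp -[RHS]fmap_id; apply: eq_fmap => u /hP[]//.
  have [Uc|Uc] := @in_ultra_setVsetC _ U [set e | e |= fmap h chi] UF.
    by left; exists (fmap h chi).
  right; exists (Neg (fmap h chi)); split=> //; last by rewrite -{2}gh.
  split=> [w|b] /= [] //; first exact: hv.1.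
  exact: hv.2.
Qed.

(* Finite satisfiability provides an ultrafilter on assignments, hence a complete
   type in the variables V; it is realised one variable at a time, along a
   well-order of V, by saturation. *)
Lemma realize_small (Sigma : set form) :
  (forall phi, Sigma phi -> forall a, free phi (inr a) -> A a) ->
  (forall s : seq form, (forall phi, List.In phi s -> Sigma phi) ->
    exists e : V -> M, forall phi, List.In phi s -> e |= phi) ->
  exists e : V -> M, forall phi, Sigma phi -> e |= phi.
Proof.
move=> SA fin.
have [m0] := carrier_inhabited M.
pose F := [set X : set (V -> M) | exists s : seq form,
  (forall phi, List.In phi s -> Sigma phi) /\
  [set e | forall phi, List.In phi s -> e |= phi] `<=` X].
have FF : ProperFilter F.
  apply: Build_ProperFilter_ex => [X [s [sS sX]]|].
    by have [e eP] := fin s sS; exists e; exact: sX.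
  split; first by exists [::].
    move=> X Y [s [sS sX]] [t [tS tY]]; exists (s ++ t); split.
      by move=> phi /List.in_app_iff[/sS|/tS].
    move=> e eP; split; [apply: sX|apply: tY] => phi h; apply: eP;
      apply/List.in_app_iff; [by left|by right].
  by move=> X Y XY [s [sS sX]]; exists s; split=> // e /sX/XY.
have [U [UF FU]] := ultraFilterLemma FF.
have US phi : Sigma phi -> U [set e | e |= phi].
  move=> Sphi; apply: FU; exists [:: phi]; split=> [psi [<-|[]]//|e].
  by apply; left.
pose elem e D := forall psi, vars_in D psi -> U [set e | e |= psi] -> e |= psi.
have elem_ext e e' D : (forall w, D w -> e w = e' w) -> elem e D -> elem e' D.
  move=> ee eD psi vp Up; have := eD _ vp Up; apply: sat_ext => -[w|b] //= fw.
  by apply: ee; exact: vp.1.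
have [lt lto] := strict_wo_exists V; have [wf tr tot] := lto.
have irr := wf_irr wf.
pose le v := [set w | lt w v] `|` [set v].
pose ext v (rec : forall w, lt w v -> M) w :=
  if pselect (lt w v) is left h then rec w h else m0.
pose upd (v : V) (a : M) (e : V -> M) w := if pselect (w = v) then a else e w.
have /choice[pick pickP] : forall P : set M, exists a, P !=set0 -> P a.
  move=> P; have [[a Pa]|nP] := pselect (P !=set0); first by exists a.
  by exists m0.
(* The value at [v] is one that keeps the assignment faithful to [U] up to [v], if there is any;
   [m0] fills the places not yet reached. *)
pose e := Fix wf (fun _ => M) (fun v rec =>
  pick [set a | elem (upd v a (ext v rec)) (le v)]).
have eE v : e v = pick [set a | elem (upd v a (ext v (fun w _ => e w))) (le v)].
  rewrite {1}/e Fix_eq // => w f f' ff; congr pick; apply/funext => a /=.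
  suff -> : ext w f = ext w f' by [].
  by apply/funext => u; rewrite /ext; case: pselect.
have elem_list D : (forall w, D w -> elem e (le w)) -> elem e D.
  move=> De psi [vp vA] Up.
  have /finite_setList[s sP] : finite_set [set v | free psi (inl v)].
    have : finite_set (inl @^-1` free psi : set V).
      by apply: finite_preimage => [x y _ _ []//|]; exact: free_finite.
    by [].
  (* The largest variable of a formula bounds all of them; a formula without variables is decided by
     any assignment in a set of [U]. *)
  have [s0|[m /sP ms mP]] := list_max s lto.
    have [e' e'P] := filter_ex Up.
    apply: sat_ext e'P => -[w|b] //= fw.
    by have /sP := fw; rewrite s0.
  apply: (De m (vp _ ms)) => //; split=> // w fw.
  by have [|->|wm] := mP w; [exact/sP|right|left].
have eD v : elem e (le v).
  elim: (wf v) => {}v _ IH.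
  have e_lt : elem (ext v (fun w _ => e w)) [set w | lt w v].
    apply: elem_ext (elem_list [set w | lt w v] IH) => w wv.
    by rewrite /ext; case: pselect.
  have [|a aP] := realize_step UF (D := [set w | lt w v]) (v := v) _ e_lt.
    exact: irr.
  have : elem (upd v (e v) (ext v (fun w _ => e w))) (le v).
    have := pickP [set b | elem (upd v b (ext v (fun w _ => e w))) (le v)].
    by rewrite -eE; apply; exists a.
  apply: elem_ext => w; rewrite /upd; case: pselect => /= [-> //|wv] [wv'|//].
  by rewrite /ext; case: pselect.
exists e => phi Sphi.
apply: (elem_list setT (fun w _ => eD w) phi _ (US _ Sphi)).
by split=> // a; exact: SA.
Qed.

End Realize.

(** * Automorphisms and dividing *)

Section Consistency.
Variables (L : language) (M : structure L) (n : nat).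
Implicit Types (S : set (pformula M n)) (phi : pformula M n).

Lemma consistentP S : consistent S <->
  forall s, (forall phi, List.In phi s -> S phi) ->
    exists x : 'I_n -> M, forall phi, List.In phi s -> psat x phi.
Proof.
split=> H.
  move=> s sS; apply: (H [set phi | List.In phi s]) => //.
  by apply/finite_setList; exists s.
move=> F /finite_setList[s sF] FS; have [|x xP] := H s; first by move=> phi /sF/FS.
by exists x => phi /sF/xP.
Qed.

Lemma consistent_sub S S' : S `<=` S' -> consistent S' -> consistent S.
Proof. by move=> SS c F Ff FS; apply: c => //; exact: subset_trans SS. Qed.

Lemma impliesP S phi : implies S phi <->
  exists s, (forall psi, List.In psi s -> S psi) /\
    forall x : 'I_n -> M, (forall psi, List.In psi s -> psat x psi) -> psat x phi.
Proof.
split=> [H|[s [sS sphi]] /consistentP c]; last first.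
  have [|x xP] := c (Neg phi :: s); first by move=> psi [<-|/sS]; [right|left].
  have /sphi xphi : forall psi, List.In psi s -> psat x psi.
    by move=> psi h; apply: xP; right.
  by have := xP (Neg phi) (or_introl erefl); apply.
apply: contrapT => nH; apply: H; apply/consistentP => s sS.
(* Only [Neg phi] is dropped from [s]. If [t] does not imply [phi], a counterexample realises all of
   [s]. *)
pose t := [seq psi <- s | `[< S psi >]].
have tE psi : List.In psi t <-> List.In psi s /\ S psi.
  rewrite /t; elim: s {sS t} => [|a s IH] /=; first by split=> [|[]].
  case: asboolP => Sa /=; rewrite IH; split.
  - by move=> [<-|[]]; [split=> //; left|split=> //; right].
  - by move=> [[->|]]; [left|right].
  - by move=> [h1 h2]; split=> //; right.
  - by move=> [[<-|] //].
have [x xP] : exists x : 'I_n -> M, ~ ((forall psi, List.In psi t -> psat x psi) ->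
    psat x phi).
  apply/existsNP => h; apply: nH; exists t; split=> // psi /tE[].
  by [].
have [xt xphi] : (forall psi, List.In psi t -> psat x psi) /\ ~ psat x phi.
  by apply: contrapT => h; apply: xP => xt; apply: contrapT => xphi; apply: h.
exists x => psi hpsi; case: (sS _ hpsi) => [Spsi|->//].
by apply: xt; apply/tE.
Qed.

Lemma k_inconsistent1 (I : Type) k (D : set I) (f : I -> pformula M n) :
  k_inconsistent k D (fun i => [set f i]) <->
  forall t : 'I_k -> I, injective t -> (forall j, D (t j)) ->
    ~ exists x : 'I_n -> M, forall j, psat x (f (t j)).
Proof.
split=> H t tI tD; have {H}nc := H t tI tD.
  by move=> [x xP]; apply: nc => F _ FS; exists x => phi /FS[j _ ->].
move=> /consistentP c; apply: nc.
have [|x xP] := c (map (f \o t) (enum 'I_k)).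
  by move=> phi /in_mapP[j _ <-]; exists j.
exists x => j; apply: xP; apply/in_mapP; exists j => //.
by apply/in_listP; rewrite mem_enum.
Qed.

Lemma k_inconsistent_le (I : Type) k l (D : set I) (S : I -> set (pformula M n)) :
  k <= l -> k_inconsistent k D S -> k_inconsistent l D S.
Proof.
move=> kl H t tI tD c; apply: (H (t \o widen_ord kl)) => //.
  by apply: inj_comp => // i j /(congr1 val)/= e; exact: val_inj.
  by move=> j; exact: tD.
by apply: consistent_sub c => phi [j _ h]; exists (widen_ord kl j).
Qed.

End Consistency.

Definition smap (X Y Z : Type) (f : Y -> Z) (v : X + Y) : X + Z :=
  match v with inl i => inl i | inr a => inr (f a) end.

Lemma smap_id (X Y : Type) : @smap X Y Y id = id.
Proof. by apply/funext => -[]. Qed.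

Lemma smap_comp (X Y Z T : Type) (g : Z -> T) (f : Y -> Z) :
  @smap X _ _ g \o smap f = smap (g \o f).
Proof. by apply/funext => -[]. Qed.

Lemma instE (L : language) (M : structure L) n m
    (phi : formula L ('I_n + 'I_m)) (b : 'I_m -> M) :
  inst phi b = fmap (smap b) phi.
Proof. by []. Qed.

Lemma psat_smap (L : language) (M : structure L) n X (f : X -> M)
    (phi : formula L ('I_n + X)) (x : 'I_n -> M) :
  psat x (fmap (smap f) phi) <-> sat (sum_env x f) phi.
Proof.
rewrite /psat sat_fmap; suff -> : (fun v : 'I_n + M => match v with
  | inl i => x i | inr a => a end) \o smap f = sum_env x f by [].
by apply/funext => -[].
Qed.

(** * The action of an automorphism on formulas and types *)

Section Action.
Variables (L : language) (M : structure L) (s : M -> M).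
Hypothesis sA : automorphism s.

Lemma psat_act n (phi : pformula M n) (x : 'I_n -> M) :
  psat (s \o x) (fmap (smap s) phi) <-> psat x phi.
Proof.
rewrite psat_smap -[X in _ <-> X](sat_aut _ _ sA).
by apply: sat_eq => -[].
Qed.

Lemma over_act n (A : set M) (phi : pformula M n) :
  over A phi -> over (s @` A) (fmap (smap s) phi).
Proof.
move=> phiA b; rewrite free_fmap => -[[i|a] fa //= [<-]].
by exists a => //; exact: phiA.
Qed.

Lemma over_actV n (A : set M) (phi : pformula M n) : over (s @` A) phi ->
  exists psi : pformula M n, over A psi /\ fmap (smap s) psi = phi.
Proof.
move=> phiA; have [[s' sK s'K] _ _] := sA.
exists (fmap (smap s') phi); split; last first.
  rewrite fmap_comp smap_comp; suff -> : s \o s' = id by rewrite smap_id fmap_id.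
  exact/funext.
move=> b; rewrite free_fmap => -[[i|a] fa //= [<-]].
by have [c Ac <-] := phiA _ fa; rewrite sK.
Qed.

Lemma consistent_act n (S : set (pformula M n)) :
  consistent S -> consistent [set fmap (smap s) phi | phi in S].
Proof.
move=> /consistentP c; apply/consistentP => l lS.
have [|t [t1 t2]] := @list_lift _ _
    (fun phi psi => S phi /\ fmap (smap s) phi = psi) l.
  by move=> psi /lS[phi Sphi <-]; exists phi.
have [|x xP] := c t; first by move=> phi /t1[y _ []].
by exists (s \o x) => psi /t2[phi ph [_ <-]]; apply/psat_act; exact: xP.
Qed.

Lemma implies_act n (S : set (pformula M n)) phi :
  implies S phi -> implies [set fmap (smap s) phi | phi in S] (fmap (smap s) phi).
Proof.
have [[s' sK s'K] _ _] := sA.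
move=> /impliesP[l [lS lphi]]; apply/impliesP; exists (map (fmap (smap s)) l).
split=> [_ /in_mapP[psi h <-]|x xP]; first by exists psi => //; exact: lS.
have sx : x = s \o (s' \o x) by apply/funext => i /=; rewrite s'K.
rewrite sx psat_act; apply: lphi => psi h.
by apply/psat_act; rewrite -sx; apply: xP; apply/in_mapP; exists psi.
Qed.

Lemma complete_over_act n (A : set M) (S : set (pformula M n)) :
  complete_over A S ->
  complete_over (s @` A) [set fmap (smap s) phi | phi in S].
Proof.
move=> [SA Sc Sd]; split.
- by move=> _ [phi /SA h <-]; exact: over_act.
- exact: consistent_act.
- move=> _ /over_actV[phi [phiA <-]].
  by case: (Sd phi phiA) => h; [left; exists phi|right; exists (Neg phi)].
Qed.

Lemma formula_divides_act n m (phi : formula L ('I_n + 'I_m)) b A :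
  formula_divides phi b A -> formula_divides phi (s \o b) (s @` A).
Proof.
have [[s' sK s'K] _ _] := sA.
move=> [k [c [bc /k_inconsistent1 kc]]]; exists k, (fun i => s \o c i); split.
  by move=> i _ /over_actV[chi [chiA <-]]; rewrite !psat_act; exact: bc.
apply/k_inconsistent1 => t tI tD [x xP]; apply: (kc t tI tD).
exists (s' \o x) => j; apply/psat_act.
have -> : s \o (s' \o x) = x by apply/funext => i /=; rewrite s'K.
have := xP j; rewrite !instE fmap_comp smap_comp.
by [].
Qed.

Lemma divides_act n (S : set (pformula M n)) A : divides S A ->
  divides [set fmap (smap s) phi | phi in S] (s @` A).
Proof.
move=> [m [phi [b [Sb bA]]]]; exists m, phi, (s \o b); split.
  by have := implies_act Sb; rewrite !instE fmap_comp smap_comp.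
exact: formula_divides_act.
Qed.

Variable K : Type.

Lemma small_act (A : set M) : small K A -> small K (s @` A).
Proof. by move=> KA h; apply: KA; exact: card_le_trans h (card_image_le _ _). Qed.

Definition act_ctype n (p : ctype K M n) : ctype K M n :=
  CType (small_act (@dom_small _ _ _ _ p)) (complete_over_act (@ctypeP _ _ _ _ p)).

Lemma Rd_act n (p q : ctype K M n) : Rd p q -> Rd (act_ctype p) (act_ctype q).
Proof.
move=> [pq qA]; split; last exact: divides_act.
by move=> _ [phi /pq h <-]; exists phi.
Qed.

End Action.

Section Invariance.
Variables (K : Type) (L : language) (M : structure L) (n : nat).

Definition aut_invariant (G : set (ctype K M n)) : Prop :=
  forall (s : M -> M) (sA : automorphism s) (p : ctype K M n),
    G p -> G (act_ctype sA p).

(** Conjugation preserves [Rd]. This is what keeps the conjugates of a type in {SU^d >= alpha}. *)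
Lemma rank_ge_invariant (d : Order.disp_t) (W : orderType d)
    (wfW : well_ordered W) (a : W) :
  aut_invariant (rank_ge wfW (@SUd_step K L M n) a).
Proof.
elim: (wfW a) => {}a _ IH s sA p /rank_geE[H1 H2]; apply/rank_geE; split.
  move=> b ba bs; have [q [pq Gq]] := H1 b ba bs.
  exists (act_ctype sA q); split; first exact: Rd_act.
  exact: IH.
by move=> la b ba; apply: IH => //; exact: H2.
Qed.

End Invariance.

(** * Conjugate tuples and long dividing sequences *)

Section LongSequence.
Variables (K : Type) (L : language) (M : structure L).
Hypotheses (Klarge : sufficiently_large K L) (Msat : saturated K M)
  (Mhom : strongly_homogeneous K M).

Lemma smallT_nat : smallT K nat.
Proof.
case: Klarge => _ /smallTE; apply: smallT_le; exact: embeds_nat_formula.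
Qed.

Lemma smallT_ord m : smallT K 'I_m.
Proof. by apply: smallT_le smallT_nat; exists val; exact: val_inj. Qed.

(** Homogeneity extends the map that fixes [A] and sends [b j] to [c j]. It is well defined, since
    equalities among the entries of [b], or with elements of [A], belong to the type. *)
Lemma exists_conjugation m (A : set M) (b c : 'I_m -> M) :
  small K A -> same_type A b c ->
  exists s, [/\ automorphism s, forall a, A a -> s a = a & forall j, s (b j) = c j].
Proof.
move=> KA bc.
have /choice[g gP] : forall a, exists a', (A a -> a' = a) /\
    (~ A a -> forall j, b j = a -> exists2 j', b j' = a & a' = c j').
  move=> a; have [Aa|nAa] := pselect (A a); first by exists a.
  have [[j ja]|nj] := pselect (exists j, b j = a).
    by exists (c j); split=> // _ _ _; exists j.
  by exists a; split=> // _ j ja; case: nj; exists j.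
pose X := A `|` range b.
have KX : small K X.
  apply/smallE; apply: (@smallT_le _ _ (A + 'I_m)); last first.
    case: Klarge => Kpow _; apply: smallT_sum => //; last exact: smallT_ord.
    exact/smallE.
  have /choice[f fP] : forall x : X, exists u : A + 'I_m, match u with
      inl a => val a = val x | inr w => b w = val x end.
    move=> [x /= /set_mem[Ax|[w _ <-]]]; first by exists (inl (SigSub (mem_set Ax))).
    by exists (inr w).
  exists f => x x' ex; apply: val_inj; have := fP x; have := fP x'.
  by rewrite ex; case: (f x') => [a <-|w <-].
have [|s [sA sX]] := Mhom KX (_ : elementary_on X g).
  move=> phi phiX.
  (* Replacing the entries of [b] outside [A] by variables turns a formula with parameters in [X]
     into one over [A], to which [bc] applies. *)
  have /choice[h hP] : forall a : M, exists u : 'I_m + M, X a ->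
      match u with inl j => ~ A a /\ b j = a /\ c j = g a
                 | inr a' => A a /\ a' = a end.
    move=> a; have [Aa|nAa] := pselect (A a); first by exists (inr a).
    have [[j ja]|nj] := pselect (exists j, b j = a).
      have [_ /(_ nAa _ ja)[j' j'a ->]] := gP a.
      by exists (inl j').
    by exists (inr a) => -[//|[j _ ja]]; case: nj; exists j.
  have chiA : over A (fmap h phi).
    move=> a; rewrite free_fmap => -[u /phiX/hP]; case: (h u) => // a' [Au ->] [<-].
    by [].
  have := bc _ chiA; rewrite /psat !sat_fmap => bcE.
  have -> : sat id phi <-> sat ((fun v : 'I_m + M => match v with
      | inl i => b i | inr a => a end) \o h) phi.
    by apply: sat_eq => u /phiX/hP /=; case: (h u) => [j [_ []]|a []].
  rewrite bcE; apply: sat_eq => u /phiX/hP /=.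
  by case: (h u) => [j [_ [_ ->]]|a [Au ->]] //; case: (gP u) => -> .
exists s; split=> // [a Aa|j]; first by rewrite sX; [case: (gP a) => ->|left].
rewrite sX; last by right; exists j.
have [Aj|nAj] := pselect (A (b j)).
  have [-> // _] := gP (b j).
  have := bc (Eq (FVar L 0 (inl j)) (FVar L 0 (inr (b j)))); rewrite /psat /sat /=.
  by case=> [a [//|[->//]]|/(_ erefl)].
have [_ /(_ nAj j erefl)[j' e ->]] := gP (b j).
have := bc (Eq (FVar L 0 (inl j')) (FVar L 0 (inl j))); rewrite /psat /sat /=.
by case=> [a []//|/(_ e)].
Qed.

(** Compactness: finitely many of the required conditions mention finitely many indices, and [c]
    satisfies them once these are injected into [nat]. *)
Lemma dividing_sequence n m (phi : formula L ('I_n + 'I_m)) (b : 'I_m -> M)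
    (A : set M) k (c : nat -> 'I_m -> M) (I : Type) :
  small K A -> smallT K I ->
  (forall i, same_type A b (c i)) ->
  k_inconsistent k [set: nat] (fun i => [set inst phi (c i)]) ->
  exists e : I -> 'I_m -> M, (forall i, same_type A b (e i)) /\
    k_inconsistent k [set: I] (fun i => [set inst phi (e i)]).
Proof.
move=> KA KI bc kc.
pose g (j : 'I_k) (v : 'I_n + 'I_m) : 'I_n + ('I_k * 'I_m) :=
  smap (fun l => (j, l)) v.
(* [psi] says that [k] instances of [phi] have a common solution. *)
have [psi psiP] := exn (conjs [seq fmap (g j) phi | j <- enum 'I_k]).
have {}psiP (e : 'I_k * 'I_m -> M) : sat e psi <->
    exists x, forall j, psat x (inst phi (fun l => e (j, l))).
  rewrite psiP; split=> -[x xP]; exists x.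
    move=> j; rewrite instE psat_smap.
    have /sat_fmap : sat (sum_env x e) (fmap (g j) phi).
      move/sat_conjs: xP; apply; apply/in_mapP; exists j => //.
      by apply/in_listP; rewrite mem_enum.
    by apply: sat_ext => -[].
  apply/sat_conjs => _ /in_mapP[j _ <-]; apply/sat_fmap.
  have := xP j; rewrite instE psat_smap.
  by apply: sat_ext => -[].
pose tp i (v : 'I_m + M) : I * 'I_m + M :=
  match v with inl j => inl (i, j) | inr a => inr a end.
pose tt (t : 'I_k -> I) (v : 'I_k * 'I_m) : I * 'I_m + M := inl (t v.1, v.2).
(* The set [l] confines the indices, so that a finite list of conditions can be located over
   finitely many of them. *)
pose Sig (l : set I) := [set theta : formula L (I * 'I_m + M) |
  (exists i chi, [/\ l i, over A chi, psat b chi & theta = fmap (tp i) chi]) \/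
  (exists t : 'I_k -> I, [/\ injective t, forall j, l (t j) &
     theta = fmap (tt t) (Neg psi)])].
have KV : smallT K (I * 'I_m).
  by case: Klarge => Kpow _; apply: smallT_prod => //; exact: smallT_ord.
have [|s sS|e eP] := realize_small Klarge Msat KV KA (Sigma := Sig setT).
- move=> theta [[i [chi [_ chiA _ ->]]]|[t [_ _ ->]]] a; rewrite free_fmap.
    by case=> -[j|a'] //= fa [<-]; exact: chiA.
  by case.
- have [l lP] : exists l : seq I, forall theta, List.In theta s ->
      Sig [set i | List.In i l] theta.
    elim: s sS => [|th s IH] sS; first by exists [::].
    have [|l lP] := IH; first by move=> theta h; apply: sS; right.
    have mono l' l'' : (forall i, List.In i l' -> List.In i l'') ->
        Sig [set i | List.In i l'] `<=` Sig [set i | List.In i l''].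
      move=> ll theta [[i [chi [il h1 h2 h3]]]|[t [h1 h2 h3]]].
        by left; exists i, chi; split=> //; apply: ll; exact: il.
      right; exists t; split=> // j; apply: ll; exact: h2.
    have [[i [chi [_ h1 h2 h3]]]|[t [h1 h2 h3]]] := sS th (or_introl erefl).
      exists (i :: l) => theta [<-|/lP]; last by apply: mono => i'; right.
      by left; exists i, chi; split=> //; left.
    exists (map t (enum 'I_k) ++ l) => theta [<-|/lP]; last first.
      by apply: mono => i' h; apply/List.in_app_iff; right.
    right; exists t; split=> // j; apply/List.in_app_iff; left; apply/in_mapP.
    by exists j => //; apply/in_listP; rewrite mem_enum.
  pose r (i : I) : nat := @seq.index {classic I} i l.
  have rI i i' : List.In i l -> List.In i' l -> r i = r i' -> i = i'.
    move=> /(@in_listP {classic I}) il /(@in_listP {classic I}) il' e.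
    have := @nth_index {classic I} i i l il.
    have := @nth_index {classic I} i i' l il'.
    by rewrite -/(r i) -/(r i') e => -> ->.
  exists (fun v => c (r v.1) v.2) => theta /lP.
  move=> [[i [chi [il chiA bchi ->]]]|[t [tI tl ->]]].
    have /bc : over A chi by [].
    move=> /(_ (r i))[/(_ bchi) ci _]; apply/sat_fmap; move: ci.
    by apply: sat_ext => -[].
  apply/sat_fmap => /psiP[x xP].
  apply: ((k_inconsistent1 k setT (fun i => inst phi (c i))).1 kc (r \o t)) => //.
    by move=> j j' /= /rI h; apply: tI; apply: h; exact: tl.
  by exists x => j; have := xP j.
- exists (fun i j => e (i, j)); split.
    have imp i chi : over A chi -> psat b chi -> psat (fun j => e (i, j)) chi.
      move=> chiA bchi; have /eP/sat_fmap : Sig setT (fmap (tp i) chi).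
        by left; exists i, chi.
      by apply: sat_ext => -[].
    move=> i chi chiA; split; first exact: imp.
    move=> echi; apply: contrapT => nb.
    suff /imp h : over A (Neg chi) by exact: (h i nb echi).
    by move=> a [/chiA|].
  apply/k_inconsistent1 => t tI _ [x xP].
  have /eP/sat_fmap : Sig setT (fmap (tt t) (Neg psi)) by right; exists t.
  by apply; apply/psiP; exists x => j; have := xP j.
Qed.

End LongSequence.

(** * The two successor steps *)

Lemma finite_index (T : Type) (A : set T) : finite_set A ->
  exists g : T -> nat, forall x y, A x -> A y -> g x = g y -> x = y.
Proof.
move=> /finite_setList[s sA]; exists (fun x => @seq.index {classic T} x s).
move=> x y /sA/(@in_listP {classic T}) xs /sA/(@in_listP {classic T}) ys e.
have := @nth_index {classic T} x x s xs; have := @nth_index {classic T} x y s ys.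
by rewrite e => -> ->.
Qed.

(* Otherwise [X] would embed in [kappa * nat], by sending [x] to [f x] together
   with the position of [x] in its fibre. *)
Lemma large_range (X Y kappa : Type) (f : X -> Y) :
  (forall y, finite_set (f @^-1` [set y])) -> embeds (set (kappa * nat)) X ->
  embeds kappa (range f).
Proof.
move=> ffin kX; have [//|[r rI]] := embeds_total kappa (range f).
exfalso; apply: (@cantor (kappa * nat)); apply: embeds_trans kX _.
have /choice[g gP] := fun y => finite_index (ffin y).
exists (fun x => (r (SigSub (mem_set (imageT f x))), g (f x) x)) => x x'.
by case=> /rI/(congr1 val)/= e; rewrite e => /gP; apply.
Qed.

(** * From dividing to large inconsistent families *)

Section Forward.
Variables (K : Type) (L : language) (M : structure L) (n : nat).
Hypotheses (Klarge : sufficiently_large K L) (Msat : saturated K M)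
  (Mhom : strongly_homogeneous K M).

Lemma SUd_step_SUd' (G : set (ctype K M n)) (p : ctype K M n) :
  aut_invariant G -> SUd_step G p -> SUd'_step G p.
Proof.
move=> GI [q [[pq [m [phi [b [qphi [k [c [bc kc]]]]]]]] Gq]].
have [Kpow Kf] := Klarge; have Knat := smallT_nat Klarge.
have KA := @dom_small _ _ _ _ p.
have KB := (smallE _ _).1 (@dom_small _ _ _ _ q).
have [lam [f [Klam fI lamE]]] := small_realize KB.
(* Dividing allows any [k], so [k.+2] secures the lower bound 2; [lam] has the cardinality of the
   domain of [q]. *)
exists k.+2, lam; split=> // kappa Kkappa.
(* With finite fibres ([Qfin]), this many indices leave [kappa] many distinct conjugates. *)
pose I := set (kappa * nat)%type.
have KI : smallT K I.
  by apply: smallT_set => //; apply: smallT_prod => //; exact/smallE.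
have [e [be ke]] := dividing_sequence Klarge Msat KA KI bc
  (k_inconsistent_le (leqW (leqnSn k)) kc).
have /choice[s sP] := fun i => exists_conjugation Klarge Mhom KA (be i).
pose sA i : automorphism (s i) := let: And3 h _ _ := sP i in h.
pose Q i := act_ctype (sA i) q.
have Qphi i : implies (Q i) (inst phi (e i)).
  have := implies_act (sA i) qphi; rewrite !instE fmap_comp smap_comp.
  suff -> : s i \o b = e i by [].
  by apply/funext => j /=; case: (sP i).
(* Injectivity is asked of the indices only, so that this also bounds the repetitions of a single
   type. *)
have key (t : 'I_k.+2 -> I) : injective t ->
    ~ consistent (\bigcup_j fml (Q (t j))).
  move=> tI /consistentP cons.
  apply: ((k_inconsistent1 _ _ _).1 ke t tI) => //.
  have /choice[l lP] := fun j => (impliesP _ _).1 (Qphi (t j)).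
  have [|x xP] := cons (List.flat_map l (enum 'I_k.+2)).
    move=> psi /List.in_flat_map[j [_ h]]; exists j => //.
    by case: (lP j) => + _; apply.
  exists x => j; case: (lP j) => _; apply=> psi h; apply: xP.
  apply/List.in_flat_map; exists j; split=> //.
  by apply/in_listP; rewrite mem_enum.
have Qfin y : finite_set (Q @^-1` [set y]).
  apply: contrapT => /infiniteP/card_leE nF.
  have [r rI] : embeds nat (Q @^-1` [set y]).
    by apply: embeds_trans nF; exists (fun i => SigSub (in_setT i)) => i j [].
  apply: (key (fun j => val (r (val j)))).
    by move=> i j /val_inj/rI/val_inj.
  have [_ yc _] := @ctypeP _ _ _ _ y.
  apply: consistent_sub yc => psi [j _] h.
  have <- : Q (val (r (val j))) = y by exact: set_mem (valP (r (val j))).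
  exact: h.
have [h hI] := large_range Qfin (embeds_refl I).
have hP a : range Q (val (h a)) by exact: set_mem (valP (h a)).
exists (range (fun a => val (h a))); split.
- apply: card_eq_trans (card_setT kappa); apply: inj_card_eq.
  by move=> a a' _ _ /val_inj/hI.
- move=> t tI tC.
  have /choice[u uP] : forall j, exists i, Q i = t j.
    by move=> j; have [a _ <-] := tC j; have [i _ <-] := hP a; exists i.
  have -> : \bigcup_j fml (t j) = \bigcup_j fml (Q (u j)).
    by apply: eq_bigcup => // j _; rewrite uP.
  by apply: key => j j' ujj; apply: tI; rewrite -!uP ujj.
- move=> _ [a _ <-]; have [i _ <-] := hP a; have [_ sa _] := sP i; split.
  + move=> psi ppsi; exists psi; first exact: pq.
    rewrite -[RHS]fmap_id; apply: eq_fmap => -[//|x] fx /=.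
    have [pA _ _] := @ctypeP _ _ _ _ p.
    by rewrite sa //; exact: pA fx.
  + apply: card_le_trans (card_image_le _ _) _; apply/card_leE.
    have fl x : f x \in lam by apply/mem_set; rewrite lamE; exists x.
    exists (fun x => SigSub (fl x)).
    by move=> x y /(congr1 val)/= /fI.
  + exact: GI.
Qed.

End Forward.

(** * From large inconsistent families back to dividing *)

Section Backward.
Variables (K : Type) (L : language) (M : structure L) (n : nat).
Hypothesis Klarge : sufficiently_large K L.

Lemma ctype_implied (q : ctype K M n) (s : seq (pformula M n)) phi :
  over (dom q) phi -> (forall psi, List.In psi s -> fml q psi) ->
  (forall x : 'I_n -> M, (forall psi, List.In psi s -> psat x psi) -> psat x phi) ->
  fml q phi.
Proof.
move=> phiq sq sphi; have [_ /consistentP qc qd] := @ctypeP _ _ _ _ q.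
case: (qd phi phiq) => // nphi.
have [|x xP] := qc (Neg phi :: s); first by move=> psi [<-|/sq].
have := xP (Neg phi) (or_introl erefl); case.
by apply: sphi => psi h; apply: xP; right.
Qed.

(** A type contains the elementary diagram of its domain; equal codes will therefore force their
    parameter tuples to have the same type. *)
Lemma ctype_sentence (q : ctype K M n) (theta : formula L M) :
  free theta `<=` dom q -> (sat id theta <-> fml q (fmap inr theta)).
Proof.
move=> fq; have sE (x : 'I_n -> M) : psat x (fmap inr theta) <-> sat id theta.
  by rewrite /psat sat_fmap.
split=> [th|qth].
  apply: (@ctype_implied q [::]) => // [a|x _]; last exact/sE.
  by rewrite free_fmap => -[b /fq qb [<-]].
have [_ /consistentP qc _] := @ctypeP _ _ _ _ q.
have [|x xP] := qc [:: fmap inr theta]; first by move=> _ [<-|[]].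
by apply/sE; apply: xP; left.
Qed.

Lemma SUd'_step_SUd (G : set (ctype K M n)) (p : ctype K M n) :
  SUd'_step G p -> SUd_step G p.
Proof.
move=> [k [lam [k2 Klam H]]].
have [Kpow Kf] := Klarge; have Knat := smallT_nat Klarge.
have [m0] := carrier_inhabited M.
(* [lam] can index the domain of any member of the family; [dom p] is listed separately, so that all
   enumerations agree on it. *)
pose U := option (lam + dom p).
have KU : smallT K U.
  apply: smallT_option => //; apply: smallT_sum => //; apply/smallE => //.
  exact: dom_small.
have KF : smallT K (formula L ('I_n + U)).
  apply: smallT_formula => //; last by constructor; right; exact: None.
  by apply: smallT_sum => //; exact: (smallT_ord Klarge).
pose Y := (formula L ('I_n + U) * set (formula L ('I_n + U)))%type.
have KY : smallT K Y by apply: smallT_prod => //; exact: smallT_set.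
have [Z [KZ ZP]] := erdos_rado Kpow Knat k KY.
have [kappa [z [Kkappa zI kappaE]]] := small_realize KZ.
have {H} [C [Ckappa Cinc CP]] := H kappa Kkappa.
(* [e q] lists a set containing the domain of q; the index [None] only makes the
   index set nonempty. *)
have /choice[e eP] : forall q : C, exists e : U -> M,
    (forall a : dom p, e (Some (inr a)) = val a) /\ dom (val q) `<=` range e.
  move=> [q /= /set_mem Cq]; have [_ /card_leE[j jI] _] := CP q Cq.
  have /choice[g gP] : forall l : lam, exists a,
      forall b : dom q, j b = l -> a = val b.
    move=> l; have [[b <-]|nb] := pselect (exists b, j b = l).
      by exists (val b) => b' /jI ->.
    by exists m0 => b jb; case: nb; exists b.
  exists (fun u => if u is Some u' then
    match u' with inl l => g l | inr a => val a end else m0); split=> // a qa.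
  exists (Some (inl (j (SigSub (mem_set qa))))) => //=.
  by rewrite (gP _ (SigSub (mem_set qa))).
(* The type [q] written in variables common to the whole family. *)
pose cod (q : C) := [set theta | fml (val q) (fmap (smap (e q)) theta)].
(* A single formula that witnesses the inconsistency of the members of [s], each at its own
   parameters. *)
pose bad (s : seq C) psi := (forall q, List.In q s -> cod q psi) /\
  ~ exists x : 'I_n -> M, forall q, List.In q s -> psat x (fmap (smap (e q)) psi).
have /choice[col colP] : forall s : seq C, exists y : Y,
    (exists psi, bad s psi) -> bad s y.1.
  move=> s; have [[psi h]|nh] := pselect (exists psi, bad s psi).
    by exists (psi, set0).
  by exists (Neg (Bot _ _ _), set0).
(* The second component makes the members of a homogeneous sequence conjugate
   over the domain of p. *)
pose c (s : seq C) : Y := ((col s).1, if s is q :: _ then cod q else set0).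
(* As the codes agree, the formulas of a finite inconsistent set scattered over the [k] types can be
   transferred to each of them; their conjunction is the witness. *)
have badP (s : seq C) Q : size s = k -> @uniq {classic C} s ->
    (forall q, List.In q s -> cod q = Q) -> bad s (c s).1.
  move=> sk su sQ; apply: colP.
  have s0 : exists q0, List.In q0 s.
    by case: s sk su sQ => [k0|q0 s _ _ _]; [rewrite -k0 in k2|exists q0; left].
  have [q0 q0s] := s0.
  pose t (j : 'I_k) : ctype K M n := val (nth q0 s j).
  have inN j : j < k -> List.In (nth q0 s j) s.
    move=> jk; apply/(@in_listP {classic C}); apply: (@mem_nth {classic C}).
    by rewrite sk.
  have tI : injective t.
    move=> i j /val_inj h; apply: val_inj.
    by apply/eqP; rewrite -(@nth_uniq {classic C} q0 s i j) ?sk //; exact/eqP.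
  have tC j : C (t j) by exact: set_mem (valP (nth q0 s j)).
  have : ~ consistent (\bigcup_j fml (t j)) by exact: Cinc.
  move=> /consistentP/existsNP[l /not_implyP[lP lx]].
  have /(@list_lift _ _ (fun theta chi => Q theta /\
      exists2 q, List.In q s & fmap (smap (e q)) theta = chi))[r [r1 r2]] :
      forall chi, List.In chi l -> exists theta, Q theta /\
      exists2 q, List.In q s & fmap (smap (e q)) theta = chi.
    move=> chi /lP[j _ chij]; pose q := nth q0 s j.
    have qs : List.In q s by exact: inN.
    have [qA _ _] := @ctypeP _ _ _ _ (val q).
    have [|theta thetaE] := @fmap_onto L _ _ _ (smap (e q)) chi.
      move=> [i|a] fa; first by exists (inl i).
      by have [_ /(_ a (qA _ chij _ fa))[u _ <-]] := eP q; exists (inr u).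
    exists theta; split; last by exists q.
    by rewrite -(sQ q qs) /cod /= thetaE.
  exists (conjs r); split=> [q qs|[x xP]].
    rewrite /cod /= fmap_conjs.
    have rq psi : List.In psi (map (fmap (smap (e q))) r) -> fml (val q) psi.
      move=> /in_mapP[theta /r1[chi _ [Qth _]] <-].
      by move: Qth; rewrite -(sQ q qs).
    apply: (ctype_implied _ rq); last by move=> x h; exact/sat_conjs.
    move=> a fa0; have [psi /rq qpsi fa] := free_conjs fa0.
    by have [qA _ _] := @ctypeP _ _ _ _ (val q); exact: qA qpsi _ fa.
  apply: lx; exists x => chi /r2[theta thr [_ [q qs <-]]].
  have := xP q qs; rewrite fmap_conjs => /sat_conjs; apply.
  by apply/in_mapP; exists theta.
have [lt lto] := strict_wo_exists C; have [wf _ _] := lto.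
have ZC : embeds Z C.
  have : [set: Z] #<= C.
    rewrite (card_le_eqr Ckappa) kappaE.
    by apply/card_leE; exists (fun x => SigSub (mem_set (imageT z (val x))))
      => x y /(congr1 val)/= /zI/val_inj.
  move/card_leE; apply: embeds_trans.
  by exists (fun i => SigSub (in_setT i)) => i j [].
have [h [hlt [[psi Q] hc]]] := ZP C lt c lto ZC.
have hI : injective h.
  move=> i j hij; case: (ltngtP i j) => // /hlt; rewrite hij => /(wf_irr wf) [].
(* Every [h i] starts an increasing sequence of length [k], which is nonempty as [k] is at least 2;
   the colour thus records its code. *)
have codQ i : cod (h i) = Q.
  have := hc (iota i k); rewrite size_iota iota_ltn_sorted => /(_ erefl erefl).
  by case: (k) k2 => // k' _ /= [].
have psiP (s : seq nat) : size s = k -> sorted ltn s -> bad (map h s) psi.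
  move=> sk ss; have <- : (c (map h s)).1 = psi by rewrite hc.
  apply: (badP _ Q); first by rewrite size_map.
    rewrite (@map_inj_uniq nat {classic C} h hI).
    exact: sorted_uniq ltn_trans ltnn _ ss.
  by move=> q /in_mapP[i _ <-].
have Qpsi i : cod (h i) psi.
  have [+ _] := psiP (iota i k) (size_iota _ _) (iota_ltn_sorted _ _).
  by apply; apply/in_mapP; exists i => //; case: (k) k2 => // k' _; left.
(* Finitely many variables of [U] occur in [psi]. That each [u j] really occurs puts its values into
   the domains of the types, as [hdom] needs. *)
have [m [u [phi [phiE uf]]]] : exists m (u : 'I_m -> U)
    (phi : formula L ('I_n + 'I_m)),
    fmap (smap u) phi = psi /\ forall j, free psi (inr (u j)).
  have : finite_set (inr @^-1` free psi : set U).
    by apply: finite_preimage => [x y _ _ []//|]; exact: free_finite.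
  move=> /finite_setList[s sP]; exists (size s).
  pose u (j : 'I_(size s)) := nth None s j; exists u.
  have [|phi phiE] := @fmap_onto L _ _ _ (smap u) psi.
    move=> [i|v] fv; first by exists (inl i).
    have vs : index (v : {classic U}) s < size s.
      by rewrite (@index_mem {classic U}); apply/(@in_listP {classic U})/sP.
    exists (inr (Ordinal vs)) => //=; rewrite /u /=.
    by congr inr; apply: (@nth_index {classic U}); apply/(@in_listP {classic U})/sP.
  exists phi; split=> // j; apply/sP/(@in_listP {classic U}).
  exact: (@mem_nth {classic U}).
have instu i : inst phi (e (h i) \o u) = fmap (smap (e (h i))) psi.
  by rewrite instE -phiE fmap_comp smap_comp.
have [pq0 _ Gq0] := CP _ (set_mem (valP (h 0))).
exists (val (h 0)); split=> //; split=> //.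
exists m, phi, (e (h 0) \o u); split.
  apply/impliesP; exists [:: inst phi (e (h 0) \o u)]; split=> [_ [<-|[]]|x].
    by rewrite instu; exact: Qpsi.
  by apply; left.
exists k, (fun i => e (h i) \o u); split.
  move=> i chi chip.
  have hdom l j : dom (val (h l)) (e (h l) (u j)).
    have [qA _ _] := @ctypeP _ _ _ _ (val (h l)).
    apply: qA (Qpsi l) _ _; rewrite free_fmap; exists (inr (u j)) => //.
  (* Inclusion of types gives inclusion of domains through the formulas [a = a]. *)
  have domp l : dom p `<=` dom (val (h l)).
    move=> a pa; pose aa : pformula M n := Eq (FVar L 0 (inr a)) (FVar L 0 (inr a)).
    have [+ _ _] := CP _ (set_mem (valP (h l))) => /(_ aa) paa.
    have [qA _ _] := @ctypeP _ _ _ _ (val (h l)).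
    apply: (qA aa (paa _)); last by left.
    by apply: (@ctype_implied p [::]) => // b [|] [->].
  (* As the enumerations agree on [dom p], one formula in the variables [U] expresses [chi] at every
     tuple of the sequence. *)
  have [w wP] : exists w : formula L U, forall l,
      fmap (e (h l)) w = fmap (sum_env (e (h l) \o u) id) chi.
    have [|w wE] := @fmap_onto L _ _ _ (fun v : 'I_m + dom p =>
       match v with inl j => inl j | inr a => inr (val a) end : 'I_m + M) chi.
      move=> [j|a] fa; first by exists (inl j).
      by exists (inr (SigSub (mem_set (chip _ fa)))).
    exists (fmap (sum_env u (fun a => Some (inr a))) w) => l.
    rewrite -wE !fmap_comp; congr (fmap _ w); apply/funext => -[j|a] //=.
    by case: (eP (h l)).
  have sE l : psat (e (h l) \o u) chi <-> Q (fmap inr w).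
    rewrite -(codQ l) /cod /= fmap_comp.
    have -> : smap (e (h l)) \o inr = inr \o e (h l) :> (U -> 'I_n + M) by [].
    rewrite -fmap_comp wP -ctype_sentence ?sat_fmap.
      by rewrite /psat; split; apply: sat_ext => -[].
    move=> a; rewrite free_fmap => -[[j|b] fb <-] /=; first exact: hdom.
    by apply: domp; exact: chip.
  by rewrite !sE.
apply/k_inconsistent1 => t tI _ [x xP].
(* Homogeneity concerns increasing sequences only, and a common solution does not depend on the
   order. *)
pose s := sort leq (map t (enum 'I_k)).
have [||_ nx] := psiP s.
- by rewrite size_sort size_map size_enum_ord.
- rewrite ltn_sorted_uniq_leq sort_uniq map_inj_uniq // enum_uniq /=.
  by apply: sort_sorted; exact: leq_total.
apply: nx; exists x => _ /in_mapP[i /in_listP + <-]; rewrite mem_sort.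
by move=> /mapP[j _ ->]; rewrite -instu; exact: xP.
Qed.

End Backward.

Theorem mainTheorem2 (L : language) (T : set (sentence L)) (K : Type)
    (M : structure L) (d : Order.disp_t) (W : orderType d)
    (wfW : well_ordered W) :
  complete_theory T -> monster K T M ->
  forall (n : nat) (p : ctype K M n),
    (forall a : W,
       rank_ge wfW (@SUd'_step K L M n) a p <->
       rank_ge wfW (@SUd_step K L M n) a p) /\
    rank wfW (@SUd'_step K L M n) p = rank wfW (@SUd_step K L M n) p.
Proof.
move=> _ [Klarge _ Msat Mhom] n p.
have rE (a : W) :
    rank_ge wfW (@SUd'_step K L M n) a = rank_ge wfW (@SUd_step K L M n) a.
  elim: (wfW a) => {}a _ IH; apply/seteqP; split=> q /rank_geE[H1 H2];
    apply/rank_geE; split=> [b ba bs|la b ba].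
  - by have := H1 b ba bs; rewrite IH //; exact: SUd'_step_SUd.
  - by rewrite -IH //; exact: H2.
  (* The induction hypothesis first replaces the rank by that of dividing, for which invariance is
     established. *)
  - rewrite IH //; apply: SUd_step_SUd' => //; first exact: rank_ge_invariant.
    exact: H1.
  - by rewrite IH //; exact: H2.
split=> [a|]; first by rewrite rE.
by rewrite /rank; under eq_fun do rewrite rE.
Qed.
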